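(* Let $\Theta\subset T$ be an open set and let $\psi\in\Psi$. (i) For every $s\in(0,1]$, $$\sup_{\|f\|_{C^s(E)}\le 1}\ \sup_{\theta\in\Theta}\|f(\hat\theta)-f(\theta)\|_{L_\psi(\mathbb P_\theta)}\ \lesssim_{s,\psi}\ \Big(\sqrt{\mathfrak v_\xi(\Theta)/n}\Big)^{s}+\Delta_{\mathcal H,\psi,\Theta}(\hat\theta,\tilde\theta),$$ where $\mathcal H=\{g:\|g\|_{C^s(E)}\le 1\}$. (ii) Let $\delta>0$ be such that $\Theta_\delta\subset T$, and let $s=1+\rho$ with $\rho\in(0,1]$. Then there is a constant $c_s\in(0,1)$, depending only on $s$, such that $$\sup_{\|f\|_{C^s(\Theta_\delta)}\le 1}\ \sup_{\theta\in\Theta}\|f(\hat\theta)-f(\theta)\|_{L_\psi(\mathbb P_\theta)}\lesssim_{s,\psi}\Big[\frac{\|\Sigma\|_{L_\infty(\Theta)}^{1/2}}{n^{1/2}}+\Big(\sqrt{\tfrac{\mathfrak v_\xi(\Theta)}{n}}\Big)^{s}+\Delta^{+}_{\mathcal H,\psi,\Theta_\delta}(\hat\theta,\tilde\theta)+\sup_{\theta\in\Theta}\tilde\psi^{1/2}\big(\mathbb P\{\|\xi(\theta)\|\ge c_s\delta\sqrt n\}\big)\Big]\wedge 1,$$ where $\mathcal H=\{g:\|g\|_{C^s(\Theta_{c_s\delta})}\le 1\}$.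
   Context: Setting: $E$ is a separable Banach space with norm $\|\cdot\|$, $T\subset E$ is open. For each $\theta\in T$ an observation $X^{(n)}$ is sampled from a distribution $P^{(n)}_\theta$ (probability and expectation $\mathbb P_\theta,\mathbb E_\theta$), and $\hat\theta=\hat\theta(X^{(n)})\in T$ is an estimator of $\theta$. Functionals $f$ are bounded Borel functions on $E$; a constraint $\|f\|_{C^s(U)}\le 1$ refers to the restriction of $f$ to $U$, and it is understood that also $\sup_E|f|\le 1$. $\xi=\{\xi(\theta)\}$ is a mean zero Gaussian stochastic process with values in $E$; $\Sigma(\theta)$ is the covariance operator of $\xi(\theta)$. For $\Theta\subset T$ and $\delta>0$, $\Theta_\delta=\{\theta\in E:\mathrm{dist}(\theta,\Theta)<\delta\}$; whenever $\Theta,\delta$ with $\Theta_\delta\subset T$ are given, the convention $\xi(\theta)=0$ for $\theta\notin\Theta_\delta$ is used. The Gaussian approximation of $\hat\theta$ is $\tilde\theta=\theta+n^{-1/2}\xi(\theta)$ (under ''$\mathbb P_\theta$'', $\tilde\theta$ has this law). $\|\Sigma\|_{L_\infty(U)}=\sup_{\theta\in U}\|\Sigma(\theta)\|$ (operator norm), $\|\xi\|_{L_\infty(E)}=\sup_{\theta\in E}\|\xi(\theta)\|$, $\mathfrak v_\xi(\Theta)=\sup_{\theta\in\Theta}\mathbb E\|\xi(\theta)\|^2$. Hölder norms: for Banach spaces $E,F$, open $U\subset E$ and $g:U\to F$, $\|g\|_{L_\infty(U)}=\sup_{x\in U}\|g(x)\|$, $\|g\|_{\mathrm{Lip}_\rho(U)}=\sup_{x\neq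 x'\in U}\|g(x)-g(x')\|/\|x-x'\|^\rho$ for $\rho\in(0,1]$, $\mathrm{Lip}=\mathrm{Lip}_1$. $g^{(j)}$ denotes the $j$-th Fréchet derivative, viewed as a map into symmetric bounded $j$-linear forms with the operator norm. For $s=m+\rho$, $m\ge 0$ an integer, $\rho\in(0,1]$, and $m$ times Fréchet differentiable $g$: $\|g\|_{C^s(U)}=\max(\|g\|_{L_\infty(U)},\max_{0\le j\le m-1}\|g^{(j)}\|_{\mathrm{Lip}(U)},\|g^{(m)}\|_{\mathrm{Lip}_\rho(U)})$, and for $0\le l\le m$, $\|g\|_{C^{l,s}(U)}=\max(\max_{l\le j\le m-1}\|g^{(j)}\|_{\mathrm{Lip}(U)},\|g^{(m)}\|_{\mathrm{Lip}_\rho(U)})$. Loss functions: $\Psi$ is the set of even convex functions $\psi:\mathbb R\to\mathbb R_+$ with $\psi(0)=0$, increasing on $\mathbb R_+$, and such that $c'u\le\psi(u)\le c''(e^u-1)$ for $u\ge 0$ for some constants $c',c''>0$. $\|\zeta\|_{L_\psi(\mathbb P)}=\inf\{c>0:\mathbb E\psi(|\zeta|/c)\le 1\}$, and $\tilde\psi(u)=1/\psi^{-1}(1/u)$, $u\ge 0$. Distances: for a class $\mathcal F$ of functions and random variables $\eta_1,\eta_2$ whose laws depend on $\theta$, $\Delta_{\mathcal F,\Theta}(\eta_1,\eta_2)=\sup_{\theta\in\Theta}\sup_{g\in\mathcal F}|\mathbb E_\theta g(\eta_1)-\mathbb E_\theta g(\eta_2)|$, $\Delta_{\mathcal F,\psi,\Theta}(\eta_1,\eta_2)=\sup_{\theta\in\Theta}\sup_{g\in\mathcal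 F}\big|\|g(\eta_1)\|_{L_\psi(\mathbb P_\theta)}-\|g(\eta_2)\|_{L_\psi(\mathbb P_\theta)}\big|$, and $\Delta^{+}_{\mathcal F,\psi,\Theta}=\Delta_{\mathcal F,\Theta}+\Delta_{\mathcal F,\psi,\Theta}$. $A\lesssim_{a}B$ means $A\le CB$ with $C$ depending only on $a$. *)

(* Defs.v *)
From HB Require Import structures.
From mathcomp Require Import all_boot all_order all_algebra.
From mathcomp Require Import all_classical all_reals all_analysis.
Set Implicit Arguments.
Unset Strict Implicit.
Unset Printing Implicit Defensive.
Import Order.TTheory GRing.Theory Num.Theory.
Local Open Scope classical_set_scope.
Local Open Scope ring_scope.

Definition borelE {R : realType} {E : normedModType R} (A : set E) : Prop :=
  <<s [set O : set E | open O] >> A.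

Definition borel_fun {R : realType} {E : normedModType R} (f : E -> R) : Prop :=
  forall B : set R, measurable B -> borelE (f @^-1` B).

Definition measE {R : realType} {E : normedModType R} {d : measure_display}
  {Om : measurableType d} (X : Om -> E) : Prop :=
  forall A : set E, borelE A -> measurable (X @^-1` A).

Definition separable {R : realType} (E : normedModType R) : Prop :=
  exists D : set E, countable D /\ closure D = setT.

Definition enlarge {R : realType} {E : normedModType R} (Th : set E) (del : R)
  : set E := [set x | exists y, Th y /\ `|x - y| < del].

Definition linfun {R : realType} {E : normedModType R} (u : E -> R) : Prop :=
  forall (a : R) (x y : E), u (a *: x + y) = a * u x + u y.

Definition cont_dual {R : realType} (E : normedModType R) : set (E -> R) :=
  [set u | linfun u /\ exists K : R, forall x, `|u x| <= K * `|x|].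

Definition dual_ball {R : realType} (E : normedModType R) : set (E -> R) :=
  [set u | linfun u /\ forall x, `|u x| <= `|x|].

Definition centered_gaussian_real {R : realType} {d : measure_display}
  {Om : measurableType d} (Q : probability Om R) (Y : Om -> R) : Prop :=
  (forall B : set R, measurable B -> Q (Y @^-1` B) = \d_(0 : R) B) \/
  exists2 sg : R, 0 < sg &
    forall B : set R, measurable B -> Q (Y @^-1` B) = normal_prob 0 sg B.

Definition centered_gaussian {R : realType} {E : normedModType R}
  {d : measure_display} {Om : measurableType d} (Q : probability Om R)
  (X : Om -> E) : Prop :=
  measE X /\ forall u, @cont_dual _ E u -> centered_gaussian_real Q (u \o X).

Definition Psi_class {R : realType} (psi : R -> R) : Prop :=
  [/\ forall u, psi (- u) = psi u,
      forall x y t, 0 <= t <= 1 ->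
        psi (t * x + (1 - t) * y) <= t * psi x + (1 - t) * psi y,
      (forall u, 0 <= psi u) /\ psi 0 = 0,
      forall x y, 0 <= x -> x <= y -> psi x <= psi y &
      exists c1 c2 : R, [/\ 0 < c1, 0 < c2 &
        forall u, 0 <= u -> c1 * u <= psi u /\ psi u <= c2 * (expR u - 1)]].

Definition Lpsi_norm {R : realType} {d : measure_display} {Om : measurableType d}
  (psi : R -> R) (P : probability Om R) (z : Om -> R) : \bar R :=
  ereal_inf [set c%:E | c in
    [set c : R | 0 < c /\ (\int[P]_w (psi (`|z w| / c))%:E <= 1)%E]].

Definition psi_inv {R : realType} (psi : R -> R) (y : R) : R :=
  sup [set u : R | 0 <= u /\ psi u <= y].

Definition psi_tilde {R : realType} (psi : R -> R) (u : R) : R :=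
  if u <= 0 then 0 else (psi_inv psi u^-1)^-1.

Definition C0_le1 {R : realType} {E : normedModType R} (rho : R) (U : set E)
  (f : E -> R) : Prop :=
  (forall x, U x -> `|f x| <= 1) /\
  (forall x y, U x -> U y -> x <> y -> `|f x - f y| <= `|x - y| `^ rho).

(* ||f||_{C^{1+rho}(U)} <= 1, rho in (0,1]  (m = 1); the Lip_rho seminorm of
   the Frechet derivative is taken in operator norm. *)
Definition C1_le1 {R : realType} {E : normedModType R} (rho : R) (U : set E)
  (f : E -> R) : Prop :=
  [/\ forall x, U x -> differentiable f x,
      forall x, U x -> `|f x| <= 1,
      forall x y, U x -> U y -> `|f x - f y| <= `|x - y| &
      forall x y (h : E), U x -> U y -> x <> y ->
        `|'d f x h - 'd f y h| <= `|x - y| `^ rho * `|h| ].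

Definition holder_ball {R : realType} {E : normedModType R} (s : R) (U : set E)
  : set (E -> R) :=
  [set g | [/\ borel_fun g, forall x, `|g x| <= 1 &
             if s <= 1 then C0_le1 s U g else C1_le1 (s - 1) U g]].

Definition gapprox {R : realType} {E : normedModType R} {d' : measure_display}
  {Om' : measurableType d'} (xi : E -> Om' -> E) (n : nat) (th : E) (w : Om')
  : E := th + (Num.sqrt (n%:R))^-1 *: xi th w.

Definition Delta_exp {R : realType} {E : normedModType R}
  {d : measure_display} {Om : measurableType d}
  {d' : measure_display} {Om' : measurableType d'}
  (H : set (E -> R)) (Th : set E) (P : E -> probability Om R) (thhat : Om -> E)
  (Q : probability Om' R) (xi : E -> Om' -> E) (n : nat) : \bar R :=
  ereal_sup [set x | exists th g, [/\ Th th, H g &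
     x = `| \int[P th]_w (g (thhat w))%:E
            - \int[Q]_w (g (gapprox xi n th w))%:E |%E ]].

Definition Delta_psi {R : realType} {E : normedModType R}
  {d : measure_display} {Om : measurableType d}
  {d' : measure_display} {Om' : measurableType d'} (psi : R -> R)
  (H : set (E -> R)) (Th : set E) (P : E -> probability Om R) (thhat : Om -> E)
  (Q : probability Om' R) (xi : E -> Om' -> E) (n : nat) : \bar R :=
  ereal_sup [set x | exists th g, [/\ Th th, H g &
     x = `| Lpsi_norm psi (P th) (fun w => g (thhat w))
            - Lpsi_norm psi Q (fun w => g (gapprox xi n th w)) |%E ]].

Definition v_xi {R : realType} {E : normedModType R}
  {d' : measure_display} {Om' : measurableType d'}
  (Q : probability Om' R) (xi : E -> Om' -> E) (Th : set E) : \bar R :=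
  ereal_sup [set (\int[Q]_w (`|xi th w| ^+ 2)%R%:E)%E | th in Th].

(* ||Sigma||_{L_infty(Theta)} = sup_{theta in Theta} ||Sigma(theta)||, where
   ||Sigma(theta)|| = sup_{||u||,||v|| <= 1} |<Sigma(theta) u, v>|
                    = sup |E u(xi(theta)) v(xi(theta))| *)
Definition Sigma_norm {R : realType} {E : normedModType R}
  {d' : measure_display} {Om' : measurableType d'}
  (Q : probability Om' R) (xi : E -> Om' -> E) (Th : set E) : \bar R :=
  ereal_sup [set x | exists th u v, [/\ Th th, @dual_ball _ E u, @dual_ball _ E v &
     x = `| \int[Q]_w (u (xi th w) * v (xi th w))%:E |%E ]].

(* Main.v *)
(** Since (f - f(theta))/2 belongs to the class H, the distance Delta_psi replaces
    the estimator by its Gaussian approximation, and it remains to bound the psi-norm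
    of f(theta + xi/sqrt n) - f(theta).  In (i) this is at most |xi/sqrt n|^s; in (ii),
    on the event |xi| < c delta sqrt n, it is at most |f'(theta) xi|/sqrt n +
    |xi/sqrt n|^s by Taylor's formula, and the psi-norm of the indicator of the
    complementary event is psi~ of its probability.

    The psi-norms of |xi|^s (s <= 2) and of f'(theta) xi are controlled by second
    moments through Fernique's inequality, with absolute constants.  Its proof needs
    the law of two independent copies (xi, xi') to be invariant under a rotation by
    pi/4, but only on the sets {sup_k |u_k(xi)| <= s, sup_k |u_k(xi')| <= t} for a
    norming sequence (u_k) of functionals.  Expectations of cosines of linear
    combinations are invariant because a convolution of centered normal densities is
    normal; products of cosines are sums of cosines, so trigonometric polynomials
    follow, and indicators of boxes are their bounded pointwise limits. *)

Require Import Defs.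
From HB Require Import structures.
From mathcomp Require Import all_boot all_order all_algebra.
From mathcomp Require Import all_classical all_reals all_analysis.
From mathcomp Require Import measurable_realfun ring lra.
Import Order.TTheory GRing.Theory Num.Theory.
Import numFieldNormedType.Exports.
Local Open Scope classical_set_scope.
Local Open Scope ring_scope.
Set Implicit Arguments.
Unset Strict Implicit.
Unset Printing Implicit Defensive.

(** The bounds contain only second moments, while [psi] may grow exponentially. The psi-norm of a
    power of |xi| thus calls for exponential integrability, with constants that do not depend on the
    space or the law. Fernique's inequality supplies it for |xi|^2, and the exponent 1 + rho of the
    Taylor remainder stays within its reach because it is at most 2.

    The obstacle is that Gaussianity is given only through one-dimensional marginals. Fernique's
    argument asks for the joint law of two copies only on countable boxes symmetric about 0, and
    even functions, hence cosines, are enough to see these. As a box constrains infinitely many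
    coordinates, the number of coordinates and the sharpness of the cut-off have to grow together in
    the approximation.

    The square root of psi~ in (ii) is a weakening: psi~ is bounded on [0,1], hence at most a
    constant times its own root. The truncation at 1 reflects that a bounded function has a bounded
    psi-norm. *)

Section HahnBanach.

(** * Norming functionals by the Hahn-Banach extension *)

Variables (R : realType) (E : normedModType R) (x0 : E).

(** A functional bounded by the norm, encoded as a linear relation. Single-valuedness is automatic,
    since [(0, r)] and its opposite together force [r = 0]. The last clause is conditional so that
    the empty relation qualifies: Zorn's lemma is applied to all chains, the empty one included. *)
Definition dominated_graph (G : set (E * R)) : Prop :=
  [/\ forall a v w, G v -> G w -> G (a *: v.1 + w.1, a * v.2 + w.2),
      forall v, G v -> v.2 <= `|v.1| &
      forall v, G v -> G (x0, `|x0|)].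

Lemma dominated_graph_bigcup (F : set (set (E * R))) :
  F `<=` dominated_graph -> total_on F subset ->
  dominated_graph (\bigcup_(X in F) X).
Proof.
move=> FP Ftot; split.
- move=> a v w [X FX Xv] [Y FY Yw].
  have [XY|YX] := Ftot _ _ FX FY.
    by exists Y => //; have [+ _ _] := FP _ FY; apply => //; exact: XY.
  by exists X => //; have [+ _ _] := FP _ FX; apply => //; exact: YX.
- by move=> v [X FX Xv]; have [_ + _] := FP _ FX; apply.
- by move=> v [X FX Xv]; exists X => //; have [_ _ +] := FP _ FX; apply; exact: Xv.
Qed.

Lemma dominated_graph_line :
  dominated_graph [set v | exists t : R, v = (t *: x0, t * `|x0|)].
Proof.
split.
- move=> a _ _ [t ->] [t' ->] /=; exists (a * t + t').
  by rewrite scalerDl scalerA mulrDl mulrA.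
- move=> _ [t ->] /=; rewrite normrZ ler_wpM2r//; exact: ler_norm.
- by move=> _ _; exists 1; rewrite scale1r mul1r.
Qed.

Lemma dominated_graph_extend (G : set (E * R)) (y : E) :
  dominated_graph G -> G (0, 0) -> (forall r, ~ G (y, r)) ->
  exists H, G `<` H /\ dominated_graph H.
Proof.
move=> [Glin Gdom Gx0] G0 Gy.
pose S := [set v.2 - `|v.1 - y| | v in G].
have Sub v w : G v -> G w -> v.2 - `|v.1 - y| <= `|w.1 + y| - w.2.
  move=> Gv Gw; have /Gdom /= := Glin 1 _ _ Gv Gw.
  rewrite scale1r mul1r lerBrDr addrAC lerBlDr => /le_trans; apply.
  have -> : v.1 + w.1 = (w.1 + y) + (v.1 - y) by rewrite addrACA subrr addr0 addrC.
  exact: ler_normD.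
have S0 : S (0 - `|0 - y|) by exists (0, 0).
have hS : has_sup S.
  split; first by exists (0 - `|0 - y|).
  by exists (`|0 + y| - 0) => _ [v Gv <-]; exact: (Sub _ (0, 0)).
(* The value at [y] has to be at least every [v.2 - |v.1 - y|] and at most every [|w.1 + y| - w.2];
   by [Sub] these do not cross. Dividing by [|t|] reduces all multiples of [y] to these two
   constraints. *)
pose r := sup S.
have rlo v : G v -> v.2 - `|v.1 - y| <= r.
  by move=> Gv; apply: ub_le_sup; [exact: hS.2|exists v].
have rup w : G w -> r <= `|w.1 + y| - w.2.
  by move=> Gw; apply: ge_sup; [exact: hS.1|move=> _ [v Gv <-]; exact: Sub].
have Gscale a v : G v -> G (a *: v.1, a * v.2).
  by move=> Gv; have := Glin a _ _ Gv G0; rewrite !addr0.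
pose H := [set v | exists w t, G w /\ v = (w.1 + t *: y, w.2 + t * r)].
exists H; split.
  split; last first.
    move=> HG; apply: (Gy r); apply: HG; exists (0, 0), 1.
    by rewrite /= scale1r mul1r !add0r.
  by move=> v Gv; exists v, 0; rewrite scale0r mul0r !addr0 -surjective_pairing.
split.
- move=> a _ _ [v [t [Gv ->]]] [w [t' [Gw ->]]] /=.
  exists (a *: v.1 + w.1, a * v.2 + w.2), (a * t + t'); split.
    exact: Glin.
  rewrite /= scalerDr scalerA scalerDl addrACA; congr pair; ring.
- move=> _ [w [t [Gw ->]]] /=.
  have [t0|t0|->] := ltgtP t 0; last by rewrite scale0r mul0r !addr0; exact: Gdom.
  + have := rlo _ (Gscale (- t)^-1 _ Gw) => /=.
    have nt : 0 < - t by rewrite oppr_gt0.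
    have -> : `|w.1 + t *: y| = (- t) * `|(- t)^-1 *: w.1 - y|.
      rewrite -[X in X * _](gtr0_norm nt) -normrZ scalerBr scalerA mulfV ?gt_eqF//.
      by rewrite scale1r scaleNr opprK.
    rewrite lerBlDr -(ler_pM2l nt) mulrDr mulrA mulfV ?gt_eqF// mul1r => h; lra.
  + have := rup _ (Gscale t^-1 _ Gw) => /=.
    have -> : `|w.1 + t *: y| = t * `|t^-1 *: w.1 + y|.
      rewrite -[X in X * _](gtr0_norm t0) -normrZ scalerDr scalerA mulfV ?gt_eqF//.
      by rewrite scale1r.
    rewrite -(ler_pM2l t0) mulrBr mulrA mulfV ?gt_eqF// mul1r => h; lra.
- move=> _ _; exists (x0, `|x0|), 0.
  by rewrite scale0r mul0r !addr0; split => //; exact: (Gx0 (0,0)).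
Qed.

Lemma norming_functional : exists2 u : E -> R, @dual_ball R E u & u x0 = `|x0|.
Proof.
have [G [PG Gmax]] := Zorn_bigcup dominated_graph_bigcup.
have [v0 Gv0] : exists v, G v.
  (* The empty relation is strictly contained in the line through [x0], hence not maximal. *)
  apply: contrapT => /forallNP G0; apply: (Gmax _ _ dominated_graph_line); split.
    by move=> v /G0.
  by move=> /(_ (x0, `|x0|))/= h; apply: (G0 (x0, `|x0|)); apply: h; exists 1;
     rewrite scale1r mul1r.
have [Glin Gdom Gx0] := PG.
have G0 : G (0, 0).
  have := Glin (- 1) _ _ Gv0 Gv0.
  by rewrite scaleN1r mulN1r !addNr.
have Gtot y : exists r, G (y, r).
  apply: contrapT => /forallNP Gy.
  by have [H [GH PH]] := dominated_graph_extend PG G0 Gy; exact: (Gmax H).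
have Guniq y r r' : G (y, r) -> G (y, r') -> r = r'.
  have le a b : G (y, a) -> G (y, b) -> b <= a.
    move=> Ga Gb; have /Gdom := Glin (- 1) _ _ Ga Gb.
    by rewrite /= scaleN1r addNr normr0 mulN1r addrC subr_le0.
  by move=> h h'; apply/eqP; rewrite eq_le !le.
have [u Gu] := choice Gtot.
exists u; last exact: (Guniq x0 _ _ (Gu x0) (Gx0 _ Gv0)).
have ulin : Defs.linfun u.
  move=> a x y; apply: (Guniq (a *: x + y)) => //.
  exact: (Glin a (x, u x) (y, u y)).
split => // x; rewrite ler_norml (Gdom _ (Gu x)) andbT lerNl.
have := Gdom _ (Glin (- 1) _ _ (Gu x) G0).
by rewrite /= !addr0 scaleN1r normrN mulN1r.
Qed.

End HahnBanach.

(** * Countable norming families in a separable space *)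

Section NormingSequence.
Variables (R : realType) (E : normedModType R).

Lemma linfun0 (u : E -> R) : Defs.linfun u -> u 0 = 0.
Proof.
by move=> ul; have := ul (- 1) 0 0; rewrite scaler0 addr0 mulN1r addNr.
Qed.

Lemma linfunB (u : E -> R) x y : Defs.linfun u -> u (x - y) = u x - u y.
Proof.
by move=> ul; have := ul (- 1) y x; rewrite scaleN1r mulN1r addrC [RHS]addrC.
Qed.

(** The functionals are norming at a dense sequence; at distance [eps / 2] from [e k], both [|x|]
    and [u k x] move by at most [eps / 2]. The equivalence turns balls into countable intersections
    of slabs, and thereby the norm into scalar Gaussian variables. *)
Lemma norming_sequence : separable E ->
  exists2 u : nat -> E -> R, forall k, @dual_ball R E (u k) &
    forall x t, `|x| <= t <-> forall k, `|u k x| <= t.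
Proof.
move=> [D [cD clD]].
have [e De] : exists e : nat -> E, D `<=` range e.
  have /pcard_surjP[g gD] := cD.
  by exists g => x Dx; have [k _ <-] := gD x Dx; exists k.
have [u uP] := choice (fun k => let: ex_intro2 u h1 h2 := norming_functional (e k) in
  ex_intro (fun u : E -> R => @dual_ball R E u /\ u (e k) = `|e k|) u (conj h1 h2)).
exists u => [k|x t]; first by have [] := uP k.
split=> [xt k|ut].
  by have [[_ h] _] := uP k; exact: le_trans (h x) xt.
apply/ler_addgt0Pr => eps eps0.
have : closure D x by rewrite clD.
have e2 : 0 < eps / 2 by rewrite divr_gt0.
move=> /(_ _ (nbhsx_ballx x (eps / 2) e2))[y [/De[k _ <-]]].
rewrite -ball_normE /= => xy.
have [[ul ub] uk] := uP k.
have h1 : `|x| <= `|e k| + eps / 2.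
  rewrite -[x in `|x|](subrKC (e k)) (le_trans (ler_normD _ _))// lerD2l; exact: ltW.
have h2 : `|e k| - u k x <= eps / 2.
  rewrite -uk -linfunB// (le_trans (ler_norm _))// (le_trans (ub _))// distrC.
  exact: ltW.
have h3 := le_trans (ler_norm _) (ut k).
lra.
Qed.

End NormingSequence.

(** * Normal densities and their convolution *)

Notation std_pdf := (normal_pdf 0 1).

Section NormalDensity.
Variable R : realType.
Notation mu := (@lebesgue_measure R).
Implicit Types h : R -> R.

Lemma std_pdfE (x : R) : std_pdf x = normal_peak 1 * expR (- (x ^+ 2 / 2)).
Proof.
rewrite normal_pdfE ?oner_eq0// /normal_fun subr0 expr1n mulNr; congr (_ * expR (- (_ * _^-1))).
Qed.

Lemma normal_peakE (s : R) : 0 < s -> normal_peak s = s^-1 * normal_peak 1.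
Proof.
move=> s0; rewrite /normal_peak expr1n mul1r -mulrnAr sqrtrM ?sqr_ge0//.
by rewrite sqrtr_sqr gtr0_norm// invfM.
Qed.

Lemma normal_pdf_std (m s x : R) : 0 < s ->
  normal_pdf m s x = s^-1 * std_pdf ((x - m) / s).
Proof.
move=> s0; rewrite std_pdfE mulrA -normal_peakE// normal_pdfE ?gt_eqF//.
congr (_ * expR _); rewrite mulNr exprMn exprVn -mulr_natr invfM mulrA //.
Qed.

Lemma continuous_std_pdf : continuous (@normal_pdf R 0 1).
Proof. by apply: continuous_normal_pdf; rewrite oner_eq0. Qed.

Lemma integral_affine_subst (a b : R) h : 0 < a -> continuous h ->
  (forall x, 0 <= h x) ->
  (\int[mu]_x (h x)%:E = \int[mu]_x (h (a * x + b) * a)%:E)%E.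
Proof.
move=> a0 hc h0; pose F x : R := a * x + b.
have dF (x : R) : is_derive x 1 F a.
  by apply: is_derive_eq; rewrite addr0 /GRing.scale/= mulr1.
have F'E : (F^`())%classic = cst a.
  by apply/funext => x; rewrite derive1E; exact: derive_val.
rewrite (@increasing_ge0_integration_by_substitutionT R F h)//.
- by apply: eq_integral => x _; rewrite F'E.
- by move=> x y xy; rewrite /F ltrD2r ltr_pM2l.
- by rewrite F'E => ?; exact: cvg_cst.
- by rewrite F'E; exact: is_cvg_cst.
- by rewrite F'E; exact: is_cvg_cst.
- by apply: cvg_trans (gt0_cvgMrNy a0 (cvg_addrr_Ny (b / a))); apply: near_eq_cvg;
    near=> x; rewrite /F mulrDr mulrCA divff ?gt_eqF// mulr1.
- by apply: cvg_trans (gt0_cvgMry a0 (cvg_addrr (b / a))); apply: near_eq_cvg;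
    near=> x; rewrite /F mulrDr mulrCA divff ?gt_eqF// mulr1.
Unshelve. all: end_near. Qed.

Lemma integral_std_scale (s : R) h : 0 < s -> continuous h ->
  (forall x, 0 <= h x) ->
  (\int[mu]_x (h x * normal_pdf 0 s x)%:E = \int[mu]_x (h (s * x) * std_pdf x)%:E)%E.
Proof.
move=> s0 hc h0; rewrite (@integral_affine_subst s 0)//; last 2 first.
- move=> x; apply: cvgM; first exact: hc.
  by apply: continuous_normal_pdf; rewrite gt_eqF.
- by move=> x; rewrite mulr_ge0// normal_pdf_ge0.
apply: eq_integral => x _; congr EFin.
rewrite addr0 normal_pdf_std// subr0.
have -> : s * x / s = x by field; rewrite gt_eqF.
by field; rewrite gt_eqF.
Qed.

(** The explicit density and the Radon-Nikodym derivative have the same integral over every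
    measurable set, so they agree almost everywhere. *)
Lemma integral_normal_prob (s : R) h : 0 < s -> measurable_fun setT h ->
  (forall x, 0 <= h x) ->
  (\int[normal_prob 0 s]_x (h x)%:E = \int[mu]_x (h x * normal_pdf 0 s x)%:E)%E.
Proof.
move=> s0 mh h0.
have dom := normal_prob_dominates (0 : R) s.
rewrite -(Radon_Nikodym_SigmaFinite.change_of_variables dom)//=; first last.
  exact/measurable_EFinP.
set f := Radon_Nikodym_SigmaFinite.f _ _.
have fi : mu.-integrable setT f := Radon_Nikodym_SigmaFinite.f_integrable dom.
apply: ae_eq_integral => //.
- apply: emeasurable_funM; [exact/measurable_EFinP|exact: (measurable_int mu)].
- by apply/measurable_EFinP/measurable_funM => //; exact: measurable_normal_pdf.
under [X in ae_eq _ _ _ X]eq_fun do rewrite EFinM.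
apply: ae_eqe_mul2l; apply: integral_ae_eq => //.
- by apply/measurable_EFinP; exact: measurable_normal_pdf.
- by move=> A _ mA; rewrite -(Radon_Nikodym_SigmaFinite.f_integral dom).
Qed.

Lemma integral_std_cst (k : R) : 0 <= k ->
  (\int[mu]_x (k * std_pdf x)%:E = k%:E)%E.
Proof.
move=> k0; under eq_integral do rewrite EFinM.
rewrite ge0_integralZl_EFin//=.
- by rewrite integral_normal_pdf mule1.
- by move=> x _; rewrite lee_fin normal_pdf_ge0.
- by apply/measurable_EFinP; exact: measurable_normal_pdf.
Qed.

(** Completing the square in [y]. On the left is the joint density at [(z, y)] of [(a X + b Y, Y)]
    for independent standard normal X, Y; on the right, the density of the first coordinate times
    the conditional density of the second. *)
Lemma normal_pdf_convolution (a b z y : R) (c := Num.sqrt (a ^+ 2 + b ^+ 2)) :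
  0 < a -> 0 < b ->
  a^-1 * std_pdf ((z - b * y) / a) * std_pdf y =
  c^-1 * std_pdf (z / c) * normal_pdf (z * b / c ^+ 2) (a / c) y.
Proof.
move=> a0 b0.
have c20 : 0 < a ^+ 2 + b ^+ 2 by rewrite addr_gt0// exprn_gt0.
have c0 : 0 < c by rewrite sqrtr_gt0.
have c2 : c ^+ 2 = a ^+ 2 + b ^+ 2 by rewrite sqr_sqrtr// ltW.
rewrite (normal_pdf_std (z * b / _)) ?divr_gt0// !std_pdfE.
have expE : expR (- (((z - b * y) / a) ^+ 2 / 2)) * expR (- (y ^+ 2 / 2)) =
    expR (- ((z / c) ^+ 2 / 2)) *
    expR (- (((y - z * b / c ^+ 2) / (a / c)) ^+ 2 / 2)).
  rewrite -!expRD; congr expR.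
  have -> : (y - z * b / c ^+ 2) / (a / c) = (c * y - z * b / c) / a.
    by field; rewrite !gt_eqF.
  rewrite !exprMn !exprVn.
  have -> : (c * y - z * b / c) ^+ 2 =
      c ^+ 2 * y ^+ 2 - 2 * y * z * b + z ^+ 2 * b ^+ 2 / c ^+ 2.
    by field; rewrite gt_eqF.
  by rewrite c2; field; rewrite !gt_eqF.
move: expE; set e1 := expR _; set e2 := expR _; set e3 := expR _; set e4 := expR _.
move=> expE; set k := normal_peak 1.
have -> : a^-1 * (k * e1) * (k * e2) = a^-1 * k * k * (e1 * e2) by ring.
by rewrite expE; field; rewrite !gt_eqF.
Qed.

(** For positive coefficients, substitute [z = a x + b y] and integrate [y] out first: its
    conditional density has mass one. Zero coefficients are included because a centered Gaussian
    variable may be degenerate. *)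
Lemma integral_std_convolution (a b : R) h : 0 <= a -> 0 <= b ->
  continuous h -> (forall x, 0 <= h x) ->
  (\int[mu]_y (\int[mu]_x (h (a * x + b * y) * std_pdf x)%:E * (std_pdf y)%:E) =
   \int[mu]_x (h (Num.sqrt (a ^+ 2 + b ^+ 2) * x) * std_pdf x)%:E)%E.
Proof.
move=> + + hc h0; rewrite le_eqVlt => /predU1P[<- b0|a0].
  rewrite expr0n/= add0r sqrtr_sqr ger0_norm//; apply: eq_integral => y _.
  under eq_integral do rewrite mul0r add0r.
  by rewrite integral_std_cst// EFinM.
rewrite le_eqVlt => /predU1P[<-|b0].
  rewrite expr0n/= addr0 sqrtr_sqr gtr0_norm//.
  under eq_integral do under eq_integral do rewrite mul0r addr0.
  rewrite ge0_integralZl//.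
  - by rewrite integral_normal_pdf mule1.
  - by apply/measurable_EFinP; exact: measurable_normal_pdf.
  - by move=> x _; rewrite lee_fin normal_pdf_ge0.
  - by apply: integral_ge0 => x _; rewrite lee_fin mulr_ge0// normal_pdf_ge0.
set c := Num.sqrt _.
have c0 : 0 < c by rewrite sqrtr_gt0 addr_gt0// exprn_gt0.
have mp : measurable_fun setT (@normal_pdf R 0 1) by exact: measurable_normal_pdf.
have mh : measurable_fun setT h by exact: continuous_measurable_fun.
have cp y : continuous (fun z : R => a^-1 * std_pdf ((z - b * y) / a)).
  move=> z; apply: cvgM; first exact: cvg_cst.
  apply: continuous_cvg; first exact: continuous_std_pdf.
  apply: cvgM; last exact: cvg_cst.
  by apply: cvgB; [exact: cvg_id|exact: cvg_cst].
transitivity (\int[mu]_y \int[mu]_z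
    (h z * (a^-1 * std_pdf ((z - b * y) / a) * std_pdf y))%:E)%E.
  apply: eq_integral => y _.
  rewrite -ge0_integralZr//; first last.
  - by rewrite lee_fin normal_pdf_ge0.
  - by move=> x _; rewrite lee_fin mulr_ge0// normal_pdf_ge0.
  - apply/measurable_EFinP/measurable_funM => //.
    apply: measurableT_comp => //; apply: measurable_funD => //.
  rewrite [RHS](@integral_affine_subst a (b * y))//; first last.
  - by move=> z; rewrite !mulr_ge0 ?invr_ge0 ?normal_pdf_ge0// ltW.
  - move=> z; apply: cvgM; [exact: hc|].
    by apply: cvgM; [exact: cp|exact: cvg_cst].
  apply: eq_integral => x _; rewrite -EFinM; congr EFin.
  have -> : (a * x + b * y - b * y) / a = x by field; rewrite gt_eqF.
  by field; rewrite gt_eqF.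
rewrite (@fubini_tonelli _ _ _ _ _ mu mu (fun zy => (h zy.2 *
   (a^-1 * std_pdf ((zy.2 - b * zy.1) / a) * std_pdf zy.1))%:E)); first last.
- by move=> x; rewrite lee_fin !mulr_ge0 ?invr_ge0 ?normal_pdf_ge0// ltW.
- apply/measurable_EFinP/measurable_funM; first exact: measurableT_comp.
  apply: measurable_funM; last exact: measurableT_comp.
  apply: measurable_funM => //; apply: measurableT_comp => //.
  apply: measurable_funM => //; apply: measurable_funB => //.
  exact: (measurableT_comp (mulrl_measurable b) measurable_fst).
rewrite /=.
transitivity (\int[mu]_z (h z * normal_pdf 0 c z)%:E)%E; last first.
  exact: integral_std_scale.
apply: eq_integral => z _ /=.
under eq_integral do rewrite normal_pdf_convolution// -/c mulrA EFinM.
rewrite ge0_integralZl_EFin//=.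
- by rewrite integral_normal_pdf mule1 (normal_pdf_std 0 z c0) subr0.
- by move=> x _; rewrite lee_fin normal_pdf_ge0.
- by apply/measurable_EFinP; exact: measurable_normal_pdf.
- by rewrite !mulr_ge0 ?invr_ge0 ?normal_pdf_ge0// ltW.
Qed.

End NormalDensity.

(** * Trigonometric approximation of the indicator of an interval *)

Section BoxFunctions.
Variable R : realType.
Implicit Types x y : R.

(** For [y > 0] the mean value theorem gives [sin y = y cos c] with [0 < c < y], and
    [cos^2 c = 1 - sin^2 c >= 1 - y^2]. *)
Lemma sin2_bounds y : y ^+ 2 * (1 - y ^+ 2) <= sin y ^+ 2 <= y ^+ 2.
Proof.
wlog y0 : y / 0 < y.
  move=> H; have [y0|y0|<-] := ltgtP 0 y; first exact: H.
  - by have := H (- y); rewrite oppr_gt0 sinN !sqrrN; exact.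
  - by rewrite sin0 !expr0n/= mul0r lexx.
have s2 x : 0 < x -> exists2 c, 0 < c < x & sin x = x * cos c.
  move=> x0.
  have [c] : exists2 c, c \in `]0, x[%R & sin x - sin 0 = cos c * (x - 0).
    apply: MVT => //.
    by apply: continuous_subspaceT; exact: continuous_sin.
  rewrite in_itv/= => cx; rewrite sin0 !subr0 => ->.
  by exists c => //; rewrite mulrC.
have le2 x : 0 < x -> sin x ^+ 2 <= x ^+ 2.
  move=> /s2[c _ ->]; rewrite exprMn ler_piMr ?sqr_ge0//.
rewrite le2// andbT; have [c /andP[c0 cy] ->] := s2 _ y0.
rewrite exprMn ler_wpM2l ?sqr_ge0// cos2sin2 lerD2l lerN2.
apply: le_trans (le2 _ c0) _.
by rewrite lerXn2r ?nnegrE ?ltW.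
Qed.

Lemma bernoulli_ge y n : 0 <= y -> 1 + n%:R * y <= (1 + y) ^+ n.
Proof.
move=> y0; elim: n => [|n IH]; first by rewrite mul0r addr0 expr0.
rewrite exprS; apply: (@le_trans _ _ ((1 + y) * (1 + n%:R * y))).
  rewrite -natr1; have : 0 <= n%:R * y ^+ 2 by rewrite mulr_ge0// sqr_ge0.
  by nra.
by rewrite ler_wpM2l// addr_ge0.
Qed.

(** Bernoulli's inequality together with [(1 - y)^n (1 + y)^n = (1 - y^2)^n <= 1]. *)
Lemma onem_expr_le y n : 0 <= y -> y <= 1 -> (1 - y) ^+ n * (1 + n%:R * y) <= 1.
Proof.
move=> y0 y1; have y1' : 0 <= 1 - y by rewrite subr_ge0.
apply: (@le_trans _ _ ((1 - y) ^+ n * (1 + y) ^+ n)).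
  by rewrite ler_wpM2l ?exprn_ge0// bernoulli_ge.
rewrite -exprMn exprn_ile1//.
  by rewrite mulr_ge0// addr_ge0.
by have := sqr_ge0 y; nra.
Qed.

Lemma onem_expr_ge y n : 0 <= y -> y <= 1 -> 1 - n%:R * y <= (1 - y) ^+ n.
Proof.
move=> y0 y1; elim: n => [|n IH]; first by rewrite mul0r subr0 expr0.
rewrite exprS; apply: (@le_trans _ _ ((1 - y) * (1 - n%:R * y))).
  rewrite -natr1; have : 0 <= n%:R * y ^+ 2 by rewrite mulr_ge0// sqr_ge0.
  by nra.
by rewrite ler_wpM2l// subr_ge0.
Qed.

(** For [z = sin^2 (x / m)], the number [(m^2 - m) z] is at most [1 - 1/m] if [|x| <= 1], and for
    large [m] exceeds 1 by a fixed amount if [|x| > 1]. The power [m^3] brings the former below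
    [m^-2], small enough for a product of [m] bumps still to tend to 1. *)
Definition bump_power (m : nat) : nat := m ^ 3.
Definition bump_mult (m : nat) : nat := (m ^ 2 - m) ^ bump_power m.

(* Brosowski-Deutsch: [(1 - z ^ n) ^ (k ^ n)] tends to [1] for [z < 1/k] and to
   [0] for [z > 1/k]; here [z = sin^2 (x / m)] and [1/k] is close to [1/m^2], so
   that the limit is the indicator of [|x| <= 1]. *)
Definition box_bump (m : nat) x : R :=
  (1 - (sin (x / m%:R) ^+ 2) ^+ bump_power m) ^+ bump_mult m.

Lemma bump_ge0 m x : 0 <= box_bump m x.
Proof.
rewrite exprn_ge0// subr_ge0 exprn_ile1 ?sqr_ge0//.
Qed.

Lemma bump_le1 m x : box_bump m x <= 1.
Proof.
rewrite exprn_ile1//.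
  by rewrite subr_ge0 exprn_ile1 ?sqr_ge0// -real_normK ?num_real// exprn_ile1// sin_max.
by rewrite lerBlDr lerDl exprn_ge0// sqr_ge0.
Qed.

Let multE m : (0 < m)%N ->
  (bump_mult m)%:R = ((m%:R ^+ 2 - m%:R) : R) ^+ bump_power m.
Proof.
move=> m0; rewrite /bump_mult natrX natrB ?natrX//.
by rewrite expnS expn1 leq_pmulr.
Qed.

Lemma bump_lower m x : (0 < m)%N -> `|x| <= 1 -> 1 - (m%:R ^+ 2)^-1 <= box_bump m x.
Proof.
move=> m0 x1; have mR : 0 < m%:R :> R by rewrite ltr0n.
have m1 : 1 <= m%:R :> R by rewrite ler1n.
set z := (sin (x / m%:R) ^+ 2) ^+ bump_power m.
have z0 : 0 <= z by rewrite exprn_ge0// sqr_ge0.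
have z1 : z <= 1.
  by rewrite exprn_ile1 ?sqr_ge0// -real_normK ?num_real// exprn_ile1// sin_max.
apply: le_trans (onem_expr_ge (bump_mult m) z0 z1).
rewrite lerD2l lerN2 multE// -exprMn.
have y0 : 0 <= m%:R^-1 :> R by rewrite invr_ge0 ltW.
have y1 : m%:R^-1 <= 1 :> R by rewrite invf_le1.
apply: (@le_trans _ _ ((1 - m%:R^-1) ^+ bump_power m)).
  have h0 : 0 <= m%:R ^+ 2 - m%:R :> R.
    by rewrite subr_ge0 expr2 ler_peMr// ltW.
  apply: lerXn2r; rewrite ?nnegrE ?subr_ge0//; first by rewrite mulr_ge0 ?sqr_ge0.
  have /andP[_ h] := sin2_bounds (x / m%:R).
  apply: (@le_trans _ _ ((m%:R ^+ 2 - m%:R) * (m%:R^-1) ^+ 2)).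
    rewrite ler_wpM2l// (le_trans h)// exprMn ler_piMl ?sqr_ge0//.
    by rewrite -real_normK ?num_real// exprn_ile1.
  by rewrite le_eqVlt; apply/orP; left; apply/eqP; field; rewrite gt_eqF.
have := onem_expr_le (bump_power m) y0 y1.
have -> : (bump_power m)%:R * m%:R^-1 = m%:R ^+ 2 :> R.
  by rewrite /bump_power natrX; field; rewrite gt_eqF.
rewrite -ler_pdivlMr ?ltr_pwDl ?sqr_ge0// mul1r => /le_trans; apply.
by rewrite lef_pV2 ?posrE ?ltr_pwDl ?sqr_ge0 ?exprn_gt0// lerDr.
Qed.

(** Here [1 + e] is the midpoint of [1] and [x^2]. The lower bound on the sine makes
    [(m^2 - m) sin^2 (x / m)] at least [x^2 - x^2 (1 + x^2) / m], and the threshold on [m] keeps the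
    loss at most [e]. *)
Lemma bump_upper x (e := (x ^+ 2 - 1) / 2) : 1 < `|x| ->
  0 < e /\ forall m, (0 < m)%N -> x ^+ 2 * (1 + x ^+ 2) / e <= m%:R ->
    box_bump m x <= (e * m%:R)^-1.
Proof.
move=> x1; have x2 : 1 < x ^+ 2 by rewrite -real_normK ?num_real// exprn_egt1.
have e0 : 0 < e by rewrite divr_gt0// subr_gt0.
split=> // m m0 mx; have mR : 0 < m%:R :> R by rewrite ltr0n.
have m1 : 1 <= m%:R :> R by rewrite ler1n.
set z := (sin (x / m%:R) ^+ 2) ^+ bump_power m.
have z0 : 0 <= z by rewrite exprn_ge0// sqr_ge0.
have z1 : z <= 1.
  by rewrite exprn_ile1 ?sqr_ge0// -real_normK ?num_real// exprn_ile1// sin_max.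
have := onem_expr_le (bump_mult m) z0 z1; rewrite -/(box_bump m x).
set r := (m%:R ^+ 2 - m%:R) * sin (x / m%:R) ^+ 2.
have -> : (bump_mult m)%:R * z = r ^+ bump_power m by rewrite multE// -exprMn.
have r1 : 1 + e <= r.
  have /andP[h _] := sin2_bounds (x / m%:R).
  have h0 : 0 <= m%:R ^+ 2 - m%:R :> R.
    by rewrite subr_ge0 expr2 ler_peMr// ltW.
  apply: le_trans (ler_wpM2l h0 h).
  have -> : (m%:R ^+ 2 - m%:R) * ((x / m%:R) ^+ 2 * (1 - (x / m%:R) ^+ 2)) =
     x ^+ 2 * ((1 - m%:R^-1) * (1 - x ^+ 2 * m%:R^-1 ^+ 2)).
    by field; rewrite gt_eqF.
  set y : R := m%:R^-1.
  have y0 : 0 <= y by rewrite invr_ge0 ltW.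
  have y1 : y <= 1 by rewrite invf_le1.
  have h1 : x ^+ 2 * (1 + x ^+ 2) * y <= e.
    by rewrite /y ler_pdivrMr// [leRHS]mulrC -ler_pdivrMr.
  apply: (@le_trans _ _ (x ^+ 2 * (1 - (1 + x ^+ 2) * y))).
    by rewrite /e in h1 *; lra.
  rewrite ler_wpM2l ?sqr_ge0//.
  have : 0 <= x ^+ 2 * y * (1 - y) 
    by apply: mulr_ge0; rewrite ?subr_ge0//; apply: mulr_ge0 => //; exact: sqr_ge0.
  have : 0 <= x ^+ 2 * y ^+ 3.
    by apply: mulr_ge0; [exact: sqr_ge0|exact: exprn_ge0].
  by nra.
have h2 : e * m%:R <= r ^+ bump_power m.
  apply: (@le_trans _ _ ((1 + e) ^+ bump_power m)); last first.
    by apply: lerXn2r; rewrite // nnegrE ?addr_ge0 ?ltW// (lt_le_trans _ r1)// addr_gt0.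
  apply: (@le_trans _ _ (1 + (bump_power m)%:R * e)); last exact: bernoulli_ge (ltW e0).
  rewrite (@le_trans _ _ ((bump_power m)%:R * e))//.
    by rewrite [leLHS]mulrC ler_pM2r// ler_nat /bump_power -{1}[m]expn1 leq_pexp2l.
  by rewrite lerDr.
have em : 0 < e * m%:R by rewrite mulr_gt0.
move=> h3; rewrite -[leRHS]mul1r ler_pdivlMr// (le_trans _ h3)//.
by rewrite ler_wpM2l ?bump_ge0// (le_trans h2)// lerDr.
Qed.

End BoxFunctions.

(** * From equal cosine expectations to equal probabilities of boxes *)

Lemma cvg_invn (R : realType) : (m%:R^-1 : R) @[m --> \oo] --> (0 : R).
Proof. by rewrite -cvg_shiftS; exact: cvg_harmonic. Qed.

Section CosineAlgebra.
Context d (T : measurableType d) (R : realType) (P : probability T R).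
(** A pairing of random variables with their images under a change of variables that need not exist
    as a map of [T]. *)
Variable W : (T -> R) -> (T -> R) -> Prop.
Hypothesis Wlin : forall a b f g f' g', W f g -> W f' g' ->
  W (fun w => a * f w + b * f' w) (fun w => a * g w + b * g' w).
Hypothesis Wmeas : forall f g, W f g -> measurable_fun setT f /\ measurable_fun setT g.
Hypothesis Wcos : forall f g, W f g ->
  (\int[P]_w cos (f w) = \int[P]_w cos (g w))%R.

Definition bounded_meas (F : T -> R) :=
  measurable_fun setT F /\ exists M, forall w, `|F w| <= M.

Lemma bounded_meas_integrable F : bounded_meas F -> P.-integrable setT (EFin \o F).
Proof.
move=> [mF [M FM]]; apply: measurable_bounded_integrable => //.
  by rewrite (le_lt_trans (probability_le1 P _))// ltry.
exists M; split; first exact: num_real.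
by move=> x Mx w _; exact: le_trans (FM w) (ltW Mx).
Qed.

Lemma bounded_measD F G : bounded_meas F -> bounded_meas G ->
  bounded_meas (fun w => F w + G w).
Proof.
move=> [mF [M FM]] [mG [N GN]]; split; first exact: measurable_funD.
by exists (M + N) => w; rewrite (le_trans (ler_normD _ _))// lerD.
Qed.

Lemma bounded_measM F G : bounded_meas F -> bounded_meas G ->
  bounded_meas (fun w => F w * G w).
Proof.
move=> [mF [M FM]] [mG [N GN]]; split; first exact: measurable_funM.
by exists (M * N) => w; rewrite normrM ler_pM.
Qed.

Lemma bounded_meas_cst c : bounded_meas (fun=> c).
Proof. by split; [exact: measurable_cst|exists `|c|]. Qed.

Lemma bounded_meas_cos f : measurable_fun setT f -> bounded_meas (fun w => cos (f w)).
Proof.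
move=> mf; split; last by exists 1 => w; exact: cos_max.
by apply: measurableT_comp => //; apply: continuous_measurable_fun; exact: continuous_cos.
Qed.

(** Testing against every further cosine, instead of only integrating, makes the relation stable
    under multiplication: a product of two cosines is half the sum of the cosines of the sum and of
    the difference, which [W] relates again. *)
Definition cos_equiv (F G : T -> R) := [/\ bounded_meas F, bounded_meas G &
  forall f g, W f g ->
    (\int[P]_w (F w * cos (f w)) = \int[P]_w (G w * cos (g w)))%R].

Lemma cos_equiv1 : cos_equiv (fun=> 1) (fun=> 1).
Proof.
split; [exact: bounded_meas_cst|exact: bounded_meas_cst|move=> f g /Wcos fg].
by under eq_Rintegral do rewrite mul1r; under [RHS]eq_Rintegral do rewrite mul1r.
Qed.

Lemma cos_equivD F G F' G' : cos_equiv F G -> cos_equiv F' G' ->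
  cos_equiv (fun w => F w + F' w) (fun w => G w + G' w).
Proof.
move=> [bF bG FG] [bF' bG' FG']; split; [exact: bounded_measD|exact: bounded_measD|].
move=> f g fg; have [/bounded_meas_cos cf /bounded_meas_cos cg] := Wmeas fg.
under eq_Rintegral do rewrite mulrDl; under [RHS]eq_Rintegral do rewrite mulrDl.
rewrite !RintegralD//; last 4 first.
- by apply: bounded_meas_integrable; exact: bounded_measM.
- by apply: bounded_meas_integrable; exact: bounded_measM.
- by apply: bounded_meas_integrable; exact: bounded_measM.
- by apply: bounded_meas_integrable; exact: bounded_measM.
by rewrite (FG _ _ fg) (FG' _ _ fg).
Qed.

Lemma cos_equivZ c F G : cos_equiv F G ->
  cos_equiv (fun w => c * F w) (fun w => c * G w).
Proof.
move=> [bF bG FG]; split;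
  [by apply: bounded_measM => //; exact: bounded_meas_cst
  |by apply: bounded_measM => //; exact: bounded_meas_cst|].
move=> f g fg; have [/bounded_meas_cos cf /bounded_meas_cos cg] := Wmeas fg.
under eq_Rintegral do rewrite -mulrA; under [RHS]eq_Rintegral do rewrite -mulrA.
rewrite !RintegralZl//; last 2 first.
- by apply: bounded_meas_integrable; exact: bounded_measM.
- by apply: bounded_meas_integrable; exact: bounded_measM.
by rewrite (FG _ _ fg).
Qed.

Lemma cos_equivM F G f g : cos_equiv F G -> W f g ->
  cos_equiv (fun w => F w * cos (f w)) (fun w => G w * cos (g w)).
Proof.
move=> [bF bG FG] fg; have [/bounded_meas_cos cf /bounded_meas_cos cg] := Wmeas fg.
split; [exact: bounded_measM|exact: bounded_measM|move=> f' g' fg'].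
have prodE (x y : R) : cos x * cos y = 2^-1 * (cos (1 * x + 1 * y) + cos (1 * x + (- 1) * y)).
  by rewrite !mul1r mulN1r !cosD cosN sinN; field.
have WD := Wlin 1 1 fg fg'; have WB := Wlin 1 (- 1) fg fg'.
have [/bounded_meas_cos cfD /bounded_meas_cos cgD] := Wmeas WD.
have [/bounded_meas_cos cfB /bounded_meas_cos cgB] := Wmeas WB.
under eq_Rintegral do rewrite -mulrA prodE mulrCA mulrDr.
under [RHS]eq_Rintegral do rewrite -mulrA prodE mulrCA mulrDr.
rewrite !RintegralZl//; last 2 first.
- by apply/bounded_meas_integrable/bounded_measD; exact: bounded_measM.
- by apply/bounded_meas_integrable/bounded_measD; exact: bounded_measM.
rewrite !RintegralD//; last 4 first.
- by apply: bounded_meas_integrable; exact: bounded_measM.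
- by apply: bounded_meas_integrable; exact: bounded_measM.
- by apply: bounded_meas_integrable; exact: bounded_measM.
- by apply: bounded_meas_integrable; exact: bounded_measM.
by rewrite (FG _ _ WD) (FG _ _ WB).
Qed.

Lemma cos_equiv_poly F G f g (q : {poly R}) : cos_equiv F G -> W f g ->
  cos_equiv (fun w => F w * q.[cos (f w)]) (fun w => G w * q.[cos (g w)]).
Proof.
move=> FG fg; elim/poly_ind: q => [|q c IH].
  have := cos_equivZ 0 FG; congr cos_equiv; apply/funext => w;
    by rewrite horner0 mulr0 mul0r.
have := cos_equivD (cos_equivM IH fg) (cos_equivZ c FG).
congr cos_equiv; apply/funext => w; rewrite hornerMXaddC; ring.
Qed.

Lemma cos_equiv_integral F G : cos_equiv F G -> W (fun=> 0) (fun=> 0) ->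
  (\int[P]_w (F w)%:E = \int[P]_w (G w)%:E)%E.
Proof.
move=> [bF bG FG] W0; have := FG _ _ W0.
under eq_Rintegral do rewrite cos0 mulr1; under [RHS]eq_Rintegral do rewrite cos0 mulr1.
have fF := integrable_fin_num measurableT (bounded_meas_integrable bF).
have fG := integrable_fin_num measurableT (bounded_meas_integrable bG).
by rewrite /Rintegral => FGE; rewrite -(fineK fF) FGE fineK.
Qed.

Definition bump_poly (m : nat) : {poly R} :=
  (1 - (1 - 'X ^+ 2) ^+ bump_power m) ^+ bump_mult m.

Lemma bump_polyE m x : (bump_poly m).[cos (x / m%:R)] = box_bump m x.
Proof.
rewrite /bump_poly /box_bump !hornerE.
by rewrite sin2cos2.
Qed.

Variables (f g : nat -> T -> R).
Hypothesis Wfg : forall k, W (f k) (g k).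

(** The same [m] counts the coordinates and sharpens the cut-off, so that a single limit reaches the
    infinite box. *)
Definition bump_prod (h : nat -> T -> R) (m : nat) w : R := \prod_(i < m) box_bump m (h i w).

Lemma cos_equiv_bump_prod m : cos_equiv (bump_prod f m) (bump_prod g m).
Proof.
suff H n : cos_equiv (fun w => \prod_(i < n) box_bump m (f i w))
    (fun w => \prod_(i < n) box_bump m (g i w)) by exact: H.
elim: n => [|n IH].
  have := cos_equiv1; congr cos_equiv; apply/funext => w; by rewrite big_ord0.
have W' := Wlin m%:R^-1 0 (Wfg n) (Wfg n).
have := cos_equiv_poly (bump_poly m) IH W'.
congr cos_equiv; apply/funext => w;
  by rewrite big_ord_recr/= mul0r addr0 [_^-1 * _]mulrC bump_polyE.
Qed.

Lemma bump_prod_ge0 h m w : 0 <= bump_prod h m w.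
Proof. by apply: prodr_ge0 => i _; exact: bump_ge0. Qed.

Lemma bump_prod_le1 h m w : bump_prod h m w <= 1.
Proof.
apply: prodr_ile1 => i _.
by rewrite bump_ge0 bump_le1.
Qed.

Definition unit_box (h : nat -> T -> R) : set T := [set w | forall k, `|h k w| <= 1].

Lemma bump_prod_cvg h w : bump_prod h m w @[m --> \oo] --> (\1_(unit_box h) w : R).
Proof.
have [hw|hw] := pselect (unit_box h w).
  rewrite indicE mem_set//.
  apply: (@squeeze_cvgr _ _ _ _ (fun m => 1 - m%:R^-1) (fun=> 1)).
  - near=> m; rewrite bump_prod_le1 andbT.
    have m0 : (0 < m)%N by near: m; exists 1%N.
    have mR : 0 < m%:R :> R by rewrite ltr0n.
    have m1 : 1 <= m%:R ^+ 2 :> R by rewrite expr_ge1// ler1n.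
    (* Each of the [m] factors is at least [1 - m^-2]; Bernoulli's inequality bounds their product
       below by [1 - 1/m]. *)
    apply: (@le_trans _ _ ((1 - (m%:R ^+ 2)^-1) ^+ m)).
      apply: le_trans (onem_expr_ge _ _ _).
      - have -> : m%:R * (m%:R ^+ 2)^-1 = m%:R^-1 :> R by field; rewrite gt_eqF.
        by [].
      - by rewrite invr_ge0 sqr_ge0.
      - by rewrite invf_le1// (lt_le_trans ltr01).
    rewrite -{2}[m]card_ord -prodr_const; apply: ler_prod => i _.
    rewrite bump_lower//= andbT subr_ge0 invf_le1//.
    by rewrite (lt_le_trans ltr01).
  - rewrite -[X in _ --> X]subr0; apply: cvgB; first exact: cvg_cst.
    exact: cvg_invn.
  - exact: cvg_cst.
(* Outside the box one bad coordinate is enough: its factor is of order [1/m] and the others are at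
   most 1. *)
have [k hk] : exists k, 1 < `|h k w|.
  by apply: contrapT => /forallNP H; apply: hw => k; rewrite leNgt; apply/negP.
rewrite indicE memNset//=.
have [e0 He] := bump_upper hk; set e := (_ / 2) in e0 He.
apply: (@squeeze_cvgr _ _ _ _ (fun=> 0) (fun m => e^-1 * m%:R^-1)).
- near=> m; rewrite bump_prod_ge0/=.
  have km : (k < m)%N by near: m; exists k.+1.
  have m0 : (0 < m)%N by exact: leq_ltn_trans km.
  rewrite -invfM; apply: (@le_trans _ _ (box_bump m (h k w))); last first.
    apply: He => //; near: m; exact: nbhs_infty_ger.
  rewrite /bump_prod (bigD1 (Ordinal km))//= ler_piMr ?bump_ge0//.
  by apply: prodr_ile1 => i _; rewrite bump_ge0 bump_le1.
- exact: cvg_cst.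
- rewrite -[X in _ --> X](mulr0 e^-1); apply: cvgM; first exact: cvg_cst.
  exact: cvg_invn.
Unshelve. all: end_near. Qed.

Lemma measurable_unit_box h : (forall k, measurable_fun setT (h k)) ->
  measurable (unit_box h).
Proof.
move=> mh; have -> : unit_box h = \bigcap_k [set w | `|h k w| <= 1].
  by apply/seteqP; split=> w H k => [_|]; exact: H.
apply: bigcap_measurable => [|k _]; first by exists 0%N.
rewrite -[X in measurable X]setTI; apply: measurable_fun_le => //.
exact: measurableT_comp.
Qed.

Lemma integral_bump_prod h : (forall m, bounded_meas (bump_prod h m)) ->
  measurable (unit_box h) ->
  (\int[P]_w (bump_prod h m w)%:E)%E @[m --> \oo] --> P (unit_box h).
Proof.
move=> bh mB.
have [|||||_ _] := @dominated_convergence _ _ _ P setT measurableT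
  (fun m w => (bump_prod h m w)%:E) (fun w => (\1_(unit_box h) w)%:E) (fun=> 1%E).
- by move=> m; apply/measurable_EFinP; have [] := bh m.
- by apply/measurable_EFinP; exact: measurable_indic.
- apply: aeW => w _; apply: cvg_EFin; first exact: nearW.
  exact: bump_prod_cvg.
- exact: finite_measure_integrable_cst.
- by apply: aeW => w m _; rewrite lee_fin ger0_norm ?bump_prod_ge0 ?bump_prod_le1.
- by rewrite integral_indic// setIT.
Qed.

Lemma unit_box_eq : P (unit_box f) = P (unit_box g).
Proof.
have W0 : W (fun=> 0) (fun=> 0).
  have := Wlin 0 0 (Wfg 0) (Wfg 0); congr W; apply/funext => w;
    by rewrite !mul0r addr0.
have E m := cos_equiv_integral (cos_equiv_bump_prod m) W0.
have Cf := integral_bump_prod (fun m => let: And3 b _ _ := cos_equiv_bump_prod m in b)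
  (measurable_unit_box (fun k => (Wmeas (Wfg k)).1)).
have Cg := integral_bump_prod (fun m => let: And3 _ b _ := cos_equiv_bump_prod m in b)
  (measurable_unit_box (fun k => (Wmeas (Wfg k)).2)).
move: Cf; under eq_fun do rewrite E; move=> Cf.
exact: (cvg_unique _ Cf Cg).
Qed.

End CosineAlgebra.

(** * Scalar Gaussian laws and the rotation of two independent copies *)

Section GaussianLaw.
Context d (Om : measurableType d) (R : realType) (Q : probability Om R).
Notation mu := (@lebesgue_measure R).

(** Allowing [s = 0] puts the Dirac case and the nondegenerate case under one formula. *)
Lemma gaussian_law (Y : Om -> R) : measurable_fun setT Y ->
  centered_gaussian_real Q Y -> exists2 s, 0 <= s &
  forall h : R -> R, continuous h -> (forall x, 0 <= h x) ->
    (\int[Q]_w (h (Y w))%:E = \int[mu]_x (h (s * x) * std_pdf x)%:E)%E.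
Proof.
move=> mY gY.
have pushE (h : R -> R) : continuous h -> (forall x, 0 <= h x) ->
    (\int[Q]_w (h (Y w))%:E = \int[pushforward Q (Y : Om -> measurableTypeR R)]_x (h x)%:E)%E.
  move=> hc h0; rewrite ge0_integral_pushforward//.
  - by apply/measurable_EFinP; exact: continuous_measurable_fun.
  - by move=> x _; rewrite lee_fin.
case: gY => [Y0|[s s0 Ys]].
  exists 0 => // h hc h0; rewrite pushE//.
  rewrite (@eq_measure_integral _ _ _ _ (\d_(0 : measurableTypeR R)))//; last first.
    by move=> A mA _; exact: Y0.
  rewrite integral_dirac//; last first.
    by apply/measurable_EFinP; exact: continuous_measurable_fun.
  rewrite diracT mul1e; under eq_integral do rewrite mul0r.
  by rewrite integral_std_cst.
exists s; first exact: ltW.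
move=> h hc h0; rewrite pushE// -integral_std_scale//.
rewrite -integral_normal_prob//; last exact: continuous_measurable_fun.
apply: (@eq_measure_integral _ (measurableTypeR R) R setT (normal_prob 0 s)
  (pushforward Q (Y : Om -> measurableTypeR R))).
by move=> A mA _; exact: Ys.
Qed.

(** Variances are compared as multiples of this number; being positive and finite, it cancels. *)
Definition std_second_moment : \bar R := (\int[mu]_x (x ^+ 2 * std_pdf x)%:E)%E.

Lemma std_second_moment_gt0 : (0 < std_second_moment)%E.
Proof.
(* A lower bound for the integrand on [[1/2, 1]]: there [x^2] is smallest at the left end and the
   density at the right end. *)
pose c : R := 2^-1 ^+ 2 * std_pdf 1.
have c0 : 0 < c.
  by rewrite mulr_gt0 ?exprn_gt0// std_pdfE mulr_gt0 ?expR_gt0// normal_peak_gt0 ?oner_eq0.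
have mI : measurable (`[2^-1, 1]%classic : set R) by exact: measurable_itv.
apply: (@lt_le_trans _ _ (\int[mu]_x (c * \1_(`[2^-1, 1]) x)%:E)%E).
  under eq_integral do rewrite EFinM.
  rewrite ge0_integralZl_EFin//=; last 2 first.
  - by apply/measurable_EFinP; exact: measurable_indic.
  - exact: ltW.
  rewrite integral_indic//= setIT lebesgue_measure_itv/= lte_fin invf_lt1// ltr1n.
  by rewrite -EFinB -EFinM lte_fin mulr_gt0// subr_gt0 invf_lt1// ltr1n.
apply: ge0_le_integral => //.
- by move=> x _; rewrite lee_fin mulr_ge0// ltW.
- by apply/measurable_EFinP/measurable_funM => //; exact: measurable_indic.
- apply/measurable_EFinP/measurable_funM; first exact: measurable_funX.
  exact: measurable_normal_pdf.
move=> x _; rewrite lee_fin indicE.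
have [|_] := boolP (x \in `[2^-1, 1]%classic); last first.
  by rewrite mulr0 mulr_ge0 ?sqr_ge0 ?normal_pdf_ge0.
rewrite inE/= in_itv/= => /andP[x2 x1]; rewrite mulr1 ler_pM ?sqr_ge0 ?normal_pdf_ge0//.
  by apply: lerXn2r => //; rewrite nnegrE// (le_trans _ x2).
rewrite !std_pdfE ler_wpM2l ?normal_peak_ge0// ler_expR lerN2 ler_pM2r//.
by apply: lerXn2r => //; rewrite nnegrE// (le_trans _ x2).
Qed.

Lemma std_second_moment_lty : (std_second_moment < +oo)%E.
Proof.
(* Half of the Gaussian exponent absorbs [x^2], as [x^2 exp (- x^2 / 4) <= 4]; the other half is the
   density of variance 2 up to the factor [Num.sqrt 2]. *)
pose k : R := 4 * Num.sqrt 2.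
have r2 : 0 < Num.sqrt 2 :> R by rewrite sqrtr_gt0.
have k0 : 0 <= k by rewrite mulr_ge0// ltW.
apply: (@le_lt_trans _ _ (\int[mu]_x (k * normal_pdf 0 (Num.sqrt 2) x)%:E)%E).
  apply: ge0_le_integral => //.
  - by move=> x _; rewrite lee_fin mulr_ge0 ?sqr_ge0 ?normal_pdf_ge0.
  - apply/measurable_EFinP/measurable_funM; first exact: measurable_funX.
    exact: measurable_normal_pdf.
  - by apply/measurable_EFinP/measurable_funM => //; exact: measurable_normal_pdf.
  move=> x _; rewrite lee_fin (normal_pdf_std 0 x r2) subr0 /k mulrA -[4 * _ * _]mulrA mulfV ?gt_eqF//.
  rewrite mulr1 !std_pdfE exprMn exprVn sqr_sqrtr//.
  have -> : - (x ^+ 2 / 2) = - (x ^+ 2 / 2 / 2) + - (x ^+ 2 / 4) :> R by field.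
  have peak := @normal_peak_ge0 R 1.
  rewrite expRD; have e1 := expR_ge0 (- (x ^+ 2 / 2 / 2)).
  have e2 : x ^+ 2 * expR (- (x ^+ 2 / 4)) <= 4.
    rewrite expRN ler_pdivrMr ?expR_gt0//.
    have := expR_ge1Dx (x ^+ 2 / 4); lra.
  have := ler_wpM2l (mulr_ge0 peak e1) e2; lra.
under eq_integral do rewrite EFinM.
rewrite ge0_integralZl_EFin//=; first by rewrite integral_normal_pdf mule1 ltry.
- by move=> x _; rewrite lee_fin normal_pdf_ge0.
- by apply/measurable_EFinP; exact: measurable_normal_pdf.
Qed.

Lemma std_second_moment_scale (s : R) :
  (\int[mu]_x ((s * x) ^+ 2 * std_pdf x)%:E = (s ^+ 2)%:E * std_second_moment)%E.
Proof.
under eq_integral do rewrite exprMn -mulrA EFinM.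
rewrite ge0_integralZl_EFin//.
- by move=> x _; rewrite lee_fin mulr_ge0 ?sqr_ge0 ?normal_pdf_ge0.
- apply/measurable_EFinP/measurable_funM; first exact: measurable_funX.
  exact: measurable_normal_pdf.
- exact: sqr_ge0.
Qed.

(** The abstract form of a Gaussian vector [X]: Fernique's inequality sees only the linear space of
    the variables [u \o X]. *)
Definition gaussian_space (V : set (Om -> R)) :=
  (forall a b u v, V u -> V v -> V (fun w => a * u w + b * v w)) /\
  (forall u, V u -> measurable_fun setT u /\ centered_gaussian_real Q u).

Lemma integral_sum_indep (u v : Om -> R) (h : R -> R) (s t : R) :
  measurable_fun setT u -> measurable_fun setT v -> continuous h ->
  (forall x, 0 <= h x) -> 0 <= s -> 0 <= t ->
  (forall h : R -> R, continuous h -> (forall x, 0 <= h x) ->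
    (\int[Q]_w (h (u w))%:E = \int[mu]_x (h (s * x) * std_pdf x)%:E)%E) ->
  (forall h : R -> R, continuous h -> (forall x, 0 <= h x) ->
    (\int[Q]_w (h (v w))%:E = \int[mu]_x (h (t * x) * std_pdf x)%:E)%E) ->
  (\int[Q \x Q]_z (h (u z.1 + v z.2))%:E =
   \int[mu]_x (h (Num.sqrt (s ^+ 2 + t ^+ 2) * x) * std_pdf x)%:E)%E.
Proof.
move=> mu_ mv hc h0 s0 t0 lu lv.
have mh : measurable_fun setT h by exact: continuous_measurable_fun.
have hshift c : continuous (fun x => h (c + x)).
  move=> x; apply: (@continuous_cvg _ _ _ _ _ _ h); first exact: hc.
  by apply: cvgD; [exact: cvg_cst|exact: cvg_id].
have hshift' c : continuous (fun x => h (x + c)).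
  move=> x; apply: (@continuous_cvg _ _ _ _ _ _ h); first exact: hc.
  by apply: cvgD; [exact: cvg_id|exact: cvg_cst].
rewrite (@fubini_tonelli1 _ _ _ _ _ _ _ (fun z => (h (u z.1 + v z.2))%:E))//; first last.
- by move=> z; rewrite lee_fin.
- apply/measurable_EFinP; apply: measurableT_comp => //; apply: measurable_funD.
  + by apply: measurableT_comp => //; exact: measurable_fst.
  + by apply: measurableT_comp => //; exact: measurable_snd.
rewrite /fubini_F /=.
transitivity (\int[Q]_w \int[mu]_y (h (u w + t * y) * std_pdf y)%:E)%E.
  by apply: eq_integral => w _; exact: (lv (fun x => h (u w + x))).
rewrite (@fubini_tonelli _ _ _ _ _ Q mu
   (fun z => (h (u z.1 + t * z.2) * std_pdf z.2)%:E)); first last.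
- by move=> x; rewrite lee_fin mulr_ge0// normal_pdf_ge0.
- apply/measurable_EFinP/measurable_funM.
    apply: measurableT_comp => //; apply: measurable_funD.
      by apply: measurableT_comp => //; exact: measurable_fst.
    exact: (measurableT_comp (mulrl_measurable t) measurable_snd).
  by apply: measurableT_comp; [exact: measurable_normal_pdf|exact: measurable_snd].
rewrite -integral_std_convolution//; apply: eq_integral => y _ /=.
under eq_integral do rewrite EFinM.
rewrite ge0_integralZr//; last 3 first.
- apply/measurable_EFinP; apply: measurableT_comp => //.
  exact: measurable_funD.
- by move=> x _; rewrite lee_fin.
- by rewrite lee_fin normal_pdf_ge0.
by rewrite (lu (fun x => h (x + t * y))).
Qed.

(* Both sums are centered Gaussian, with the same variance by the parallelogram
   identity. *)
Lemma gaussian_rotation (V : set (Om -> R)) u v (r := (Num.sqrt 2)^-1) (h : R -> R) :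
  gaussian_space V -> V u -> V v -> continuous h -> (forall x, 0 <= h x) ->
  (\int[Q \x Q]_z (h (u z.1 + v z.2))%:E =
   \int[Q \x Q]_z (h ((r * u z.1 + r * v z.1) + (r * v z.2 + - r * u z.2)))%:E)%E.
Proof.
move=> [Vlin Vg] Vu Vv hc h0.
have Va := Vlin r r _ _ Vu Vv; have Vb := Vlin r (- r) _ _ Vv Vu.
have [mu_ gu] := Vg _ Vu; have [mv gv] := Vg _ Vv.
have [ma ga] := Vg _ Va; have [mb gb] := Vg _ Vb.
have [su su0 lu] := gaussian_law mu_ gu; have [sv sv0 lv] := gaussian_law mv gv.
have [sa sa0 la] := gaussian_law ma ga; have [sb sb0 lb] := gaussian_law mb gb.
rewrite (integral_sum_indep mu_ mv hc h0 su0 sv0 lu lv).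
rewrite (integral_sum_indep ma mb hc h0 sa0 sb0 la lb).
suff -> : su ^+ 2 + sv ^+ 2 = sa ^+ 2 + sb ^+ 2 by [].
have sqr_cont : continuous (fun x : R => x ^+ 2) by exact: exprn_continuous.
have sq0 (x : R) : 0 <= x ^+ 2 by exact: sqr_ge0.
have m2 (f : Om -> R) : measurable_fun setT f ->
    measurable_fun setT (fun w => ((f w) ^+ 2)%:E).
  by move=> mf; apply/measurable_EFinP; exact: measurable_funX.
have Euv : (\int[Q]_w ((u w) ^+ 2)%:E + \int[Q]_w ((v w) ^+ 2)%:E =
   \int[Q]_w ((r * u w + r * v w) ^+ 2)%:E + \int[Q]_w ((r * v w + - r * u w) ^+ 2)%:E)%E.
  rewrite -!ge0_integralD//; try (by move=> w _; rewrite lee_fin); try exact: m2.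
  apply: eq_integral => w _; rewrite -!EFinD; congr EFin.
  have r2 : r ^+ 2 = 2^-1 by rewrite exprVn sqr_sqrtr.
  have -> : (r * u w + r * v w) ^+ 2 + (r * v w + - r * u w) ^+ 2 =
     r ^+ 2 * (2 * (u w ^+ 2 + v w ^+ 2)) by ring.
  by rewrite r2 mulKf.
move: Euv; rewrite (lu _ sqr_cont sq0) (lv _ sqr_cont sq0) (la _ sqr_cont sq0) (lb _ sqr_cont sq0).
rewrite !std_second_moment_scale.
have k0 := std_second_moment_gt0; have koo := std_second_moment_lty.
have /fineK kE : std_second_moment \is a fin_num by rewrite ge0_fin_numE// ltW.
have kf : 0 < fine std_second_moment by rewrite -lte_fin kE.
rewrite -kE -!EFinM -!EFinD => -[]; rewrite -!mulrDl.
by move/mulIf; apply; rewrite gt_eqF.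
Qed.

End GaussianLaw.

(** * Fernique's inequality *)

Section Fernique.
Context d (Om : measurableType d) (R : realType) (Q : probability Om R).
Variables (V : set (Om -> R)) (U : nat -> Om -> R) (N : Om -> R).
Hypothesis gV : gaussian_space Q V.
Hypothesis VU : forall k, V (U k).
Hypothesis NU : forall w t, N w <= t <-> forall k, `|U k w| <= t.

Let r : R := (Num.sqrt 2)^-1.
Let Vlin := gV.1.
Let Vmeas u (Vu : V u) : measurable_fun setT u := (gV.2 u Vu).1.

Lemma gaussian_space0 : V (fun=> 0).
Proof.
have := Vlin 0 0 (VU 0) (VU 0); congr V; apply/funext => w.
by rewrite !mul0r addr0.
Qed.

Lemma gaussian_spaceZ a u : V u -> V (fun w => a * u w).
Proof.
move=> Vu; have := Vlin a 0 Vu Vu; congr V; apply/funext => w.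
by rewrite mul0r addr0.
Qed.

Definition level t : set Om := [set w | N w <= t].

Lemma measurable_level t : measurable (level t).
Proof.
have -> : level t = \bigcap_k [set w | `|U k w| <= t].
  by apply/seteqP; split=> w H => [k _|]; [exact: (NU w t).1 H k|apply/NU => k; exact: H].
apply: bigcap_measurable => [|k _]; first by exists 0%N.
rewrite -[X in measurable X]setTI; apply: measurable_fun_le => //.
by apply: measurableT_comp => //; exact: Vmeas.
Qed.

Definition rotated (f g : Om * Om -> R) := exists u v, [/\ V u, V v,
  f = (fun z => u z.1 + v z.2) &
  g = (fun z => (r * u z.1 + r * v z.1) + (r * v z.2 + - r * u z.2))].

Lemma rotated_lin a b f g f' g' : rotated f g -> rotated f' g' ->
  rotated (fun w => a * f w + b * f' w) (fun w => a * g w + b * g' w).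
Proof.
move=> [u [v [Vu Vv -> ->]]] [u' [v' [Vu' Vv' -> ->]]].
exists (fun w => a * u w + b * u' w), (fun w => a * v w + b * v' w).
split; [exact: Vlin|exact: Vlin| |]; apply/funext => z; ring.
Qed.

Lemma rotated_meas f g : rotated f g -> measurable_fun setT f /\ measurable_fun setT g.
Proof.
move=> [u [v [Vu Vv -> ->]]]; split.
  apply: measurable_funD.
    by apply: (measurableT_comp (Vmeas Vu)); exact: measurable_fst.
  by apply: (measurableT_comp (Vmeas Vv)); exact: measurable_snd.
apply: measurable_funD.
  apply: (measurableT_comp (f := fun w => r * u w + r * v w)); last exact: measurable_fst.
  exact: Vmeas (Vlin _ _ Vu Vv).
apply: (measurableT_comp (f := fun w => r * v w + - r * u w)); last exact: measurable_snd.
exact: Vmeas (Vlin _ _ Vv Vu).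
Qed.

Let PP : probability (Om * Om)%type R := (Q \x Q)%E.

Lemma rotated_cos f g : rotated f g ->
  (\int[PP]_w cos (f w) = \int[PP]_w cos (g w))%R.
Proof.
move=> fg; have [mf mg] := rotated_meas fg.
have [u [v [Vu Vv fE gE]]] := fg.
(* The invariance is available for nonnegative functions, hence the shift by 1. *)
have h0 (x : R) : 0 <= 1 + cos x by rewrite -lerBlDl sub0r cos_geN1.
have hc : continuous (fun x : R => 1 + cos x).
  by move=> x; apply: cvgD; [exact: cvg_cst|exact: continuous_cos].
have := gaussian_rotation gV Vu Vv hc h0.
have E (f' : Om * Om -> R) : measurable_fun setT f' ->
    (\int[PP]_z (1 + cos (f' z))%:E = (1 + \int[PP]_z cos (f' z))%R%:E)%E.
  move=> mf'; have bc := bounded_meas_cos mf'; have b1 := @bounded_meas_cst _ (Om * Om)%type R 1.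
  have one : (\int[PP]_z (1 : R) = 1)%R.
    by rewrite Rintegral_cst// mul1r; exact: (congr1 fine (probability_setT PP)).
  rewrite -[X in (X + _)%R]one -RintegralD//;
    [|exact: bounded_meas_integrable|exact: bounded_meas_integrable].
  rewrite /Rintegral fineK//; apply: integrable_fin_num => //.
  by apply: (bounded_meas_integrable PP); exact: bounded_measD.
rewrite fE gE in mf mg *.
by have := E _ mf; have := E _ mg => /= -> -> [] /addrI.
Qed.

Lemma box_independence s t : 0 < s -> 0 < t ->
  PP ([set z | forall k, `|r * U k z.1 - r * U k z.2| <= s] `&`
      [set z | forall k, `|r * U k z.1 + r * U k z.2| <= t]) =
  (Q (level s) * Q (level t))%E.
Proof.
move=> s0 t0.
(* Rescaling by [1/s] and [1/t] and interleaving by parity merges the two families of constraints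
   into a single unit box: even indices for the first copy, odd ones for the second. *)
pose f k (z : Om * Om) := if odd k then t^-1 * U k./2 z.2 else s^-1 * U k./2 z.1.
pose g k (z : Om * Om) := if odd k then t^-1 * (r * U k./2 z.1 + r * U k./2 z.2)
  else s^-1 * (r * U k./2 z.1 - r * U k./2 z.2).
have V0 := gaussian_space0.
have Wfg k : rotated (f k) (g k).
  rewrite /f /g; case: (odd k).
    exists (fun=> 0), (fun w => t^-1 * U k./2 w); split=> //.
    - exact: gaussian_spaceZ.
    - by apply/funext => z; rewrite add0r.
    - by apply/funext => z; ring.
  exists (fun w => s^-1 * U k./2 w), (fun=> 0); split=> //.
  - exact: gaussian_spaceZ.
  - by apply/funext => z; rewrite addr0.
  - by apply/funext => z; ring.
have scale (a x : R) : 0 < a -> (`|a^-1 * x| <= 1) = (`|x| <= a).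
  by move=> a0; rewrite normrM gtr0_norm ?invr_gt0// ler_pdivrMl// mulr1.
have := unit_box_eq rotated_lin rotated_meas rotated_cos Wfg.
have -> : unit_box f = level s `*` level t.
  apply/seteqP; split=> [[x y] H|[x y] [/NU H1 /NU H2] k] /=.
    split=> /=; apply/NU => k.
      by have := H k.*2; rewrite /f odd_double doubleK scale.
    by have := H k.*2.+1; rewrite /f /= odd_double uphalf_double scale.
  by rewrite /f; case: (odd k); rewrite scale//=.
have -> : unit_box g = [set z | forall k, `|r * U k z.1 - r * U k z.2| <= s] `&`
      [set z | forall k, `|r * U k z.1 + r * U k z.2| <= t].
  apply/seteqP; split=> [z H|z [H1 H2] k] /=.
    split=> k /=.
      by have := H k.*2; rewrite /g odd_double doubleK scale.
    by have := H k.*2.+1; rewrite /g /= odd_double uphalf_double scale.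
  by rewrite /g; case: (odd k); rewrite scale//=.
by move=> <-; rewrite [LHS]product_measure1E//; exact: measurable_level.
Qed.


Lemma box_marginal s : 0 < s ->
  PP [set z | forall k, `|r * U k z.1 - r * U k z.2| <= s] = Q (level s).
Proof.
move=> s0; have V0 := gaussian_space0.
pose f k (z : Om * Om) := s^-1 * U k z.1.
pose g k (z : Om * Om) := s^-1 * (r * U k z.1 - r * U k z.2).
have Wfg k : rotated (f k) (g k).
  exists (fun w => s^-1 * U k w), (fun=> 0); split=> //.
  - exact: gaussian_spaceZ.
  - by apply/funext => z; rewrite addr0.
  - by apply/funext => z; rewrite /g; ring.
have scale (x : R) : (`|s^-1 * x| <= 1) = (`|x| <= s).
  by rewrite normrM gtr0_norm ?invr_gt0// ler_pdivrMl// mulr1.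
have := unit_box_eq rotated_lin rotated_meas rotated_cos Wfg.
have -> : unit_box f = level s `*` [set: Om].
  apply/seteqP; split=> [[x y] H|[x y] [/NU H1 _] k] /=.
    by split=> //=; apply/NU => k; have := H k; rewrite /f scale.
  by rewrite /f scale/=.
have -> : unit_box g = [set z | forall k, `|r * U k z.1 - r * U k z.2| <= s].
  by apply/seteqP; split=> z H k /=; have := H k; rewrite /g scale.
move=> <-; rewrite [LHS]product_measure1E//; last exact: measurable_level.
by rewrite [X in (_ * X)%E]probability_setT mule1.
Qed.

Definition level_prob t : R := fine (Q (level t)).

Lemma level_probE t : Q (level t) = (level_prob t)%:E.
Proof. by rewrite fineK// fin_num_measure//; exact: measurable_level. Qed.

Lemma level_probC t : Q (~` level t) = (1 - level_prob t)%:E.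
Proof. by rewrite probability_setC ?level_probE//; exact: measurable_level. Qed.

Lemma integral_levelC t :
  (\int[Q]_w (\1_(~` level t) w)%:E = (1 - level_prob t)%:E)%E.
Proof.
rewrite integral_indic//; last by apply: measurableC; exact: measurable_level.
by rewrite setIT; exact: level_probC.
Qed.

Lemma level_prob_le1 t : level_prob t <= 1.
Proof. by rewrite -lee_fin -level_probE probability_le1//; exact: measurable_level. Qed.

(** The rotated pair again behaves as two independent copies. So the left side is the probability
    that every coordinate of the normalized difference is at most [s] while some coordinate [k] of
    the normalized sum exceeds [s + sqrt 2 * x]. For this [k] the triangle inequality makes both
    [|U k z.1|] and [|U k z.2|] exceed [x], and these two events are independent. *)
Lemma fernique_step s x : 0 < s -> 0 < x ->
  level_prob s * (1 - level_prob (s + Num.sqrt 2 * x)) <= (1 - level_prob x) ^+ 2.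
Proof.
move=> s0 x0; set t := s + _.
have r2 : 0 < Num.sqrt 2 :> R by rewrite sqrtr_gt0.
have t0 : 0 < t by rewrite addr_gt0// mulr_gt0.
pose A : set (Om * Om) := [set z | forall k, `|r * U k z.1 - r * U k z.2| <= s].
pose B : set (Om * Om) := [set z | forall k, `|r * U k z.1 + r * U k z.2| <= t].
have mAB (c : R) e : measurable [set z : Om * Om | forall k, `|r * U k z.1 + e * U k z.2| <= c].
  have -> : [set z : Om * Om | forall k, `|r * U k z.1 + e * U k z.2| <= c] =
      \bigcap_k [set z : Om * Om | `|r * U k z.1 + e * U k z.2| <= c].
    by apply/seteqP; split=> z H k => [_|]; exact: H.
  apply: bigcap_measurable => [|k _]; first by exists 0%N.
  rewrite -[X in measurable X]setTI; apply: measurable_fun_le => //.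
  apply: measurableT_comp => //; apply: measurable_funD; apply: measurable_funM => //.
    by apply: measurableT_comp (Vmeas (VU k)) _; exact: measurable_fst.
  by apply: measurableT_comp (Vmeas (VU k)) _; exact: measurable_snd.
have mA : measurable A.
  have := mAB s (- r); congr measurable; apply/seteqP.
  by split=> z H k; have := H k; rewrite mulNr.
have mB : measurable B by exact: mAB.
have PA : PP A = (level_prob s)%:E by rewrite -level_probE; exact: box_marginal.
have PAB : PP (A `&` B) = (level_prob s * level_prob t)%:E.
  by rewrite EFinM -!level_probE; exact: box_independence.
have PD : PP (A `\` B) = (level_prob s * (1 - level_prob t))%:E.
  have fA : (PP A < +oo)%E by rewrite PA ltry.
  have -> : PP (A `\` B) = (PP A - PP (A `&` B))%E by exact: measureD.
  by rewrite PA PAB -EFinB; congr EFin; ring.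
rewrite -lee_fin -PD.
have <- : PP (~` level x `*` ~` level x) = ((1 - level_prob x) ^+ 2)%:E.
  have mC := measurableC (measurable_level x).
  transitivity (Q (~` level x) * Q (~` level x))%E; first exact: product_measure1E.
  by rewrite !level_probC -EFinM expr2.
apply: le_measure; rewrite ?inE//.
- exact: measurableD.
- by apply: measurableX; apply: measurableC; exact: measurable_level.
move=> [w1 w2] [/= As] /existsNP[k /negP]; rewrite -ltNge => Bt.
have {}As := As k.
have rr : r * 2 = Num.sqrt 2.
  by rewrite -[X in _ * X](@sqr_sqrtr _ 2)// expr2 mulrA mulVf ?gt_eqF// mul1r.
have xlt (a b : R) : `|r * a - r * b| <= s -> t < `|r * a + r * b| ->
    x < `|a| /\ x < `|b|.
  move=> h1 h2; split; rewrite -(ltr_pM2r r2).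
    have := ler_normD (2 * r * a) (- (r * a - r * b)).
    have -> : 2 * r * a + - (r * a - r * b) = r * a + r * b by ring.
    rewrite normrN normrM [2 * r]mulrC rr (gtr0_norm r2) /t in h2 *; lra.
  have := ler_normD (2 * r * b) (r * a - r * b).
  have -> : 2 * r * b + (r * a - r * b) = r * a + r * b by ring.
  rewrite normrM [2 * r]mulrC rr (gtr0_norm r2) /t in h2 *; lra.
have [ha hb] := xlt _ _ As Bt.
split=> /= /NU /(_ k); rewrite leNgt.
  by move/negP; apply.
by move/negP; apply.
Qed.


Lemma measurable_norming : measurable_fun setT N.
Proof.
move=> mT; apply: (measurability _ (RGenOInfty.measurableE R)) => // _ [_ [x ->] <-].
rewrite setTI; have -> : N @^-1` `]x, +oo[ = ~` level x.
  by apply/seteqP; split=> w; rewrite /level /= in_itv/= andbT ltNge => /negP.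
by apply: measurableC; exact: measurable_level.
Qed.

Lemma norming_ge0 w : 0 <= N w.
Proof. by apply: le_trans (_ : `|U 0 w| <= _); [|apply/NU: 0%N]. Qed.

(** The levels linked by [fernique_step]. They grow like [2^(n/2)], so squaring the tail at each
    step amounts to a Gaussian tail. *)
Definition fernique_seq (s : R) n : R := iter n (fun x => s + Num.sqrt 2 * x) s.

Let sqrt2_ge : 7 / 5 <= Num.sqrt 2 :> R.
Proof.
rewrite -[leLHS]ger0_norm ?divr_ge0// -sqrtr_sqr ler_sqrt//; lra.
Qed.

Lemma fernique_seq_ge s n : 0 < s -> n.+1%:R * s <= fernique_seq s n.
Proof.
move=> s0; elim: n => [|n IH]; first by rewrite mul1r.
rewrite /fernique_seq iterS -/(fernique_seq s n) -[n.+2]add1n natrD mulrDl mul1r lerD2l.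
apply: (le_trans IH); apply: ler_peMl.
  by apply: (le_trans _ IH); rewrite mulr_ge0// ltW.
by apply: le_trans sqrt2_ge; lra.
Qed.

(** The coefficients give equality at [n = 0], and the induction step closes exactly when
    [sqrt 2 >= 7/5]. *)
Lemma fernique_seq_le s n : 0 < s ->
  fernique_seq s n <= (7 / 2 * Num.sqrt 2 ^+ n - 5 / 2) * s.
Proof.
move=> s0; elim: n => [|n IH]; first by rewrite expr0 /fernique_seq /=; lra.
rewrite /fernique_seq iterS -/(fernique_seq s n) exprS.
have r0 : 0 <= Num.sqrt 2 :> R by rewrite sqrtr_ge0.
have := ler_wpM2l r0 IH; have := ler_wpM2r (ltW s0) sqrt2_ge.
set c := Num.sqrt 2; set x := c ^+ n; nra.
Qed.

(** The constant 25 rounds up [(7/2)^2 * 2 = 49/2]. *)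
Lemma fernique_seq_sqr s n : 0 < s ->
  fernique_seq s n.+1 ^+ 2 <= 25 * s ^+ 2 * 2 ^+ n.
Proof.
move=> s0; have h := fernique_seq_le n.+1 s0.
have h0 : 0 <= fernique_seq s n.+1.
  by apply: le_trans (fernique_seq_ge n.+1 s0); rewrite mulr_ge0// ltW.
have h1 : fernique_seq s n.+1 <= 7 / 2 * s * Num.sqrt 2 ^+ n.+1 by lra.
have := lerXn2r 2 (_ : _ \is Num.nneg) (_ : _ \is Num.nneg) h1.
rewrite !nnegrE => /(_ h0 (le_trans h0 h1)) /le_trans; apply.
rewrite exprMn -exprM mulnC exprM sqr_sqrtr// [2 ^+ n.+1]exprS.
have -> : (7 / 2 * s) ^+ 2 * (2 * 2 ^+ n) = 49 / 2 * (s ^+ 2 * 2 ^+ n) by field.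
rewrite -[25 * _ * _]mulrA.
have : 0 <= s ^+ 2 * 2 ^+ n by rewrite mulr_ge0 ?sqr_ge0 ?exprn_ge0.
lra.
Qed.

(** By [fernique_step] the ratio of the tail to [level_prob s] at one level is at most the square of
    the ratio at the previous level; starting from [exp (- 2)], the exponent doubles. *)
Lemma fernique_tail s n : 0 < s -> 0 < level_prob s ->
  1 - level_prob s <= level_prob s * expR (- 2) ->
  1 - level_prob (fernique_seq s n) <= level_prob s * expR (- 2 * 2 ^+ n).
Proof.
move=> s0 q0 qs; elim: n => [|n IH]; first by rewrite expr0 mulr1.
have t0 : 0 < fernique_seq s n.
  by apply: lt_le_trans (fernique_seq_ge n s0); rewrite mulr_gt0.
rewrite -(ler_pM2l q0); apply: le_trans (fernique_step s0 t0) _.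
have h0 : 0 <= 1 - level_prob (fernique_seq s n) by rewrite subr_ge0 level_prob_le1.
have := lerXn2r 2 (_ : _ \is Num.nneg) (_ : _ \is Num.nneg) IH.
rewrite !nnegrE => /(_ h0 (le_trans h0 IH)) /le_trans; apply.
rewrite exprMn expr2 -mulrA !ler_pM2l// expr2 -expRD exprS.
by rewrite le_eqVlt; apply/orP; left; apply/eqP; congr expR; ring.
Qed.

Lemma level_prob_chebyshev s v : 0 < s ->
  (\int[Q]_w (N w ^+ 2)%:E <= v%:E)%E -> 1 - level_prob s <= v / s ^+ 2.
Proof.
move=> s0 Nv; rewrite ler_pdivlMr ?exprn_gt0// -lee_fin; apply: le_trans Nv.
have mC := measurableC (measurable_level s).
have -> : ((1 - level_prob s) * s ^+ 2)%:E = (\int[Q]_w (s ^+ 2 * \1_(~` level s) w)%:E)%E.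
  under eq_integral do rewrite EFinM.
  rewrite ge0_integralZl_EFin ?sqr_ge0//=; last first.
    by apply/measurable_EFinP; exact: measurable_indic.
  by rewrite integral_levelC -EFinM mulrC.
apply: ge0_le_integral => //.
- by move=> w _; rewrite lee_fin mulr_ge0 ?sqr_ge0.
- by apply/measurable_EFinP/measurable_funM => //; exact: measurable_indic.
- by apply/measurable_EFinP; apply: measurable_funX; exact: measurable_norming.
move=> w _; rewrite lee_fin indicE.
have [|_] := boolP (w \in _); last by rewrite mulr0 sqr_ge0.
rewrite inE /level /= => /negP; rewrite -ltNge mulr1 => sN.
by apply: lerXn2r; rewrite ?nnegrE ?norming_ge0 ?(ltW s0)// ltW.
Qed.

(** Chebyshev's inequality at [s^2 = (1 + e^2) v] gives a tail of at most [1 / (1 + e^2)], which is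
    the ratio [e^-2] that starts [fernique_tail]. Between levels [n] and [n + 1] the exponent is at
    most [2^n], while the probability is at most [exp (- 2 * 2^n)]; the resulting terms
    [exp (- 2^n)] add up to at most 1. *)
Lemma fernique v : 0 < v -> (\int[Q]_w (N w ^+ 2)%:E <= v%:E)%E ->
  (\int[Q]_w (expR (N w ^+ 2 / (25 * ((1 + expR 2) * v))))%:E <= (expR 1 + 1)%:E)%E.
Proof.
move=> v0 Nv; pose s := Num.sqrt ((1 + expR 2) * v).
have e2 : 0 < expR 2 :> R by exact: expR_gt0.
have c0 : 0 < (1 + expR 2) * v by rewrite mulr_gt0// addr_gt0.
have s2 : s ^+ 2 = (1 + expR 2) * v by rewrite sqr_sqrtr// ltW.
have s0 : 0 < s by rewrite sqrtr_gt0.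
rewrite -s2; have cheb := level_prob_chebyshev s0 Nv.
have vs : v / s ^+ 2 = (1 + expR 2)^-1 by rewrite s2; field; rewrite !gt_eqF// addr_gt0.
have lt1 : (1 + expR 2)^-1 < 1 :> R by rewrite invf_lt1 ?addr_gt0// ltrDl.
have q0 : 0 < level_prob s by rewrite vs in cheb; lra.
have qs : 1 - level_prob s <= level_prob s * expR (- 2).
  rewrite expRN ler_pdivlMr//; rewrite vs in cheb.
  have : (1 + expR 2) * (1 - level_prob s) <= 1 by rewrite -ler_pdivlMl ?addr_gt0// mulr1.
  lra.
have tail n := fernique_tail n s0 q0 qs.
pose g n w : \bar R := (expR (2 ^+ n) * \1_(~` level (fernique_seq s n)) w)%:E.
have g0 n w : (0 <= g n w)%E by rewrite lee_fin mulr_ge0 ?expR_ge0.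
have mg n : measurable_fun setT (g n).
  apply/measurable_EFinP/measurable_funM => //; apply: measurable_indic.
  by apply: measurableC; exact: measurable_level.
have mG : measurable_fun setT (fun w => \sum_(n <oo) g n w)%E.
  by apply: ge0_emeasurable_sum.
apply: (@le_trans _ _ (\int[Q]_w ((expR 1)%:E + \sum_(n <oo) g n w))%E).
  apply: ge0_le_integral => //.
  - apply/measurable_EFinP; apply: measurableT_comp; first exact: measurable_expR.
    by apply: measurable_funM => //; apply: measurable_funX; exact: measurable_norming.
  - by apply: emeasurable_funD.
  move=> w _.
  have [Ns|sN] := leP (N w) s.
    apply: (@le_trans _ _ (expR 1)%:E); last by rewrite leeDl// nneseries_ge0.
    rewrite lee_fin ler_expR ler_pdivrMr ?mulr_gt0 ?exprn_gt0// mul1r.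
    apply: (@le_trans _ _ (s ^+ 2)); last first.
      by rewrite ler_peMl ?sqr_ge0// ler1n.
    by apply: lerXn2r; rewrite // nnegrE ?norming_ge0// ltW.
  have exn : exists n, N w <= fernique_seq s n.
    exists (Num.trunc (N w / s)); apply: le_trans (fernique_seq_ge _ s0).
    rewrite -ler_pdivrMr// ltW//.
    by apply: truncnS_gt.
  have [[|n] Nn nmin] := ex_minnP exn.
    by move: Nn; rewrite /fernique_seq/= leNgt sN.
  have ltn : fernique_seq s n < N w.
    by rewrite ltNge; apply/negP => /nmin; rewrite ltnn.
  apply: (@le_trans _ _ (g n w)).
    rewrite lee_fin indicE mem_set ?mulr1; last first.
      by rewrite /level /=; apply/negP; rewrite -ltNge.
    rewrite ler_expR ler_pdivrMr ?mulr_gt0 ?exprn_gt0// [leRHS]mulrC.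
    apply: le_trans (fernique_seq_sqr n s0).
    by apply: lerXn2r; rewrite // nnegrE ?norming_ge0// (le_trans (norming_ge0 w)).
  apply: (@le_trans _ _ (\sum_(n <oo) g n w)%E); last by rewrite leeDr// lee_fin expR_ge0.
  apply: le_trans (nneseries_lim_ge n.+1 _) => //.
  by rewrite big_nat_recr//= leeDr// sume_ge0.
rewrite ge0_integralD//; last by move=> w _; exact: nneseries_ge0.
rewrite integral_cst// [X in (_ * X)%E]probability_setT mule1 EFinD leeD2l//.
rewrite integral_nneseries//.
(* The comparison series is that of [2^-(n+1)], by [2^(n+1) <= e^(n+1) <= e^(2^n)]. *)
have half : (\sum_(n <oo) ((1 / (2 ^ (n + 1))%:R)%:E : \bar R) = 1)%E.
  have := @cvg_geometric_eseries_half R 1 0; rewrite expr0 divr1 => /cvg_lim; exact.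
rewrite -half; apply: lee_nneseries => n _.
  by move=> _; apply: integral_ge0.
have mC := measurableC (measurable_level (fernique_seq s n)).
rewrite /g; under eq_integral do rewrite EFinM.
rewrite ge0_integralZl_EFin ?expR_ge0//=; last first.
  by apply/measurable_EFinP; exact: measurable_indic.
rewrite integral_levelC -EFinM lee_fin.
have h1 : expR (2 ^+ n) * (1 - level_prob (fernique_seq s n)) <= expR (- (2 ^+ n)).
  apply: (@le_trans _ _ (expR (2 ^+ n) * expR (- 2 * 2 ^+ n))).
    rewrite ler_wpM2l ?expR_ge0// (le_trans (tail n))// ler_piMl ?expR_ge0//.
    exact: level_prob_le1.
  rewrite -expRD le_eqVlt; apply/orP; left; apply/eqP; congr expR; ring.
have p2 : 0 < (2 ^ (n + 1))%:R :> R by rewrite ltr0n expn_gt0.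
apply: le_trans h1 _; rewrite mul1r expRN lef_pV2 ?posrE ?expR_gt0//.
rewrite addn1 natrX; apply: (@le_trans _ _ (expR 1 ^+ n.+1)).
  by apply: lerXn2r; rewrite ?nnegrE ?expR_ge0//; have := @expR_ge1Dx R 1; lra.
rewrite -expRM_natl ler_expR mulr1 -natrX ler_nat; exact: ltn_expl.
Qed.

End Fernique.

(** * Orlicz norms *)

Section Orlicz.
Context d (Om : measurableType d) (R : realType) (P : probability Om R).
Variable psi : R -> R.
Hypothesis Psi : Psi_class psi.
Implicit Types z : Om -> R.

Let psi_ge0 u : 0 <= psi u. Proof. by have [_ _ [+ _] _ _] := Psi; apply. Qed.
Let psi0 : psi 0 = 0. Proof. by have [_ _ [_ +] _ _] := Psi. Qed.
Let psi_homo x y : 0 <= x -> x <= y -> psi x <= psi y.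
Proof. by have [_ _ _ + _] := Psi; apply. Qed.
Let psi_convex x y t : 0 <= t <= 1 ->
  psi (t * x + (1 - t) * y) <= t * psi x + (1 - t) * psi y.
Proof. by have [_ + _ _ _] := Psi; apply. Qed.

(** Composing [psi] with [max 0] gives a function monotone on the whole line, hence Borel; evenness
    handles negative [c]. *)
Lemma measurable_psi_comp z c : measurable_fun setT z ->
  measurable_fun setT (fun w => psi (`|z w| / c)).
Proof.
move=> mz.
have [c0|c0] := leP 0 c.
  have -> : (fun w => psi (`|z w| / c)) =
      (fun x => psi (Num.max 0 x)) \o (fun w => `|z w| / c).
    by apply/funext => w /=; rewrite max_r// divr_ge0.
  apply: measurableT_comp.
    apply: nondecreasing_measurable => // x y xy.
    by apply: psi_homo; rewrite ?ge_max !le_max lexx// xy orbT.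
  by apply: measurable_funM => //; apply: measurableT_comp.
have -> : (fun w => psi (`|z w| / c)) =
    (fun x => psi (Num.max 0 x)) \o (fun w => `|z w| / - c).
  have [even _ _ _ _] := Psi.
  apply/funext => w /=; rewrite max_r; first by rewrite invrN mulrN even.
  by rewrite divr_ge0// oppr_ge0 ltW.
apply: measurableT_comp.
  apply: nondecreasing_measurable => // x y xy.
  by apply: psi_homo; rewrite ?ge_max !le_max lexx// xy orbT.
by apply: measurable_funM => //; apply: measurableT_comp.
Qed.

Let mpsi z c : measurable_fun setT z ->
  measurable_fun setT (fun w => (psi (`|z w| / c))%:E).
Proof. by move=> mz; apply/measurable_EFinP; exact: measurable_psi_comp. Qed.

Lemma Lpsi_norm_ge0 z : (0 <= Lpsi_norm psi P z)%E.
Proof. by apply: le_ereal_inf_tmp => _ [c [c0 _] <-]; rewrite lee_fin ltW. Qed.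

Lemma Lpsi_norm_le z c : 0 < c -> (\int[P]_w (psi (`|z w| / c))%:E <= 1)%E ->
  (Lpsi_norm psi P z <= c%:E)%E.
Proof. by move=> c0 zc; apply: ereal_inf_lbound; exists c. Qed.

Lemma le_Lpsi_norm z1 z2 : measurable_fun setT z1 -> measurable_fun setT z2 ->
  (forall w, `|z1 w| <= `|z2 w|) -> (Lpsi_norm psi P z1 <= Lpsi_norm psi P z2)%E.
Proof.
move=> m1 m2 z12; apply: le_ereal_inf_tmp => _ [c [c0 zc] <-].
apply: Lpsi_norm_le => //; apply: le_trans zc.
apply: ge0_le_integral => //; [|exact: mpsi|exact: mpsi|].
  by move=> w _; rewrite lee_fin.
move=> w _; rewrite lee_fin psi_homo ?divr_ge0 ?(ltW c0)//.
by rewrite ler_pM2r ?invr_gt0.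
Qed.

(** Convexity with weights proportional to [c1] and [c2] makes [c1 + c2] admissible. The pointwise
    hypothesis combines subadditivity with monotonicity. *)
Lemma Lpsi_norm_triangle z z1 z2 : measurable_fun setT z ->
  measurable_fun setT z1 -> measurable_fun setT z2 ->
  (forall w, `|z w| <= `|z1 w| + `|z2 w|) ->
  (Lpsi_norm psi P z <= Lpsi_norm psi P z1 + Lpsi_norm psi P z2)%E.
Proof.
move=> mz m1 m2 z12.
have adm c1 c2 : 0 < c1 -> 0 < c2 -> (\int[P]_w (psi (`|z1 w| / c1))%:E <= 1)%E ->
    (\int[P]_w (psi (`|z2 w| / c2))%:E <= 1)%E ->
    (Lpsi_norm psi P z <= (c1 + c2)%:E)%E.
  move=> c10 c20 h1 h2; have c0 : 0 < c1 + c2 by rewrite addr_gt0.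
  apply: Lpsi_norm_le => //.
  pose t := c1 / (c1 + c2).
  have t0 : 0 <= t by rewrite divr_ge0// ltW.
  have t1 : t <= 1 by rewrite ler_pdivrMr// mul1r lerDl ltW.
  have t1' : 0 <= 1 - t by rewrite subr_ge0.
  apply: (@le_trans _ _ (\int[P]_w (t%:E * (psi (`|z1 w| / c1))%:E +
      (1 - t)%:E * (psi (`|z2 w| / c2))%:E))%E).
    apply: ge0_le_integral => //.
    - by move=> w _; rewrite lee_fin.
    - exact: mpsi.
    - apply: emeasurable_funD; apply: emeasurable_funM => //; exact: mpsi.
    move=> w _; rewrite -!EFinM -EFinD lee_fin.
    apply: le_trans (psi_convex _ _ _); last by rewrite t0.
    apply: psi_homo; first by rewrite divr_ge0// ltW.
    have -> : t * (`|z1 w| / c1) + (1 - t) * (`|z2 w| / c2) =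
      (`|z1 w| + `|z2 w|) / (c1 + c2) by rewrite /t; field; rewrite !gt_eqF.
    by rewrite ler_pM2r ?invr_gt0.
  rewrite ge0_integralD//; last 4 first.
  - by move=> w _; rewrite -EFinM lee_fin mulr_ge0.
  - by apply: emeasurable_funM => //; exact: mpsi.
  - by move=> w _; rewrite -EFinM lee_fin mulr_ge0.
  - by apply: emeasurable_funM => //; exact: mpsi.
  rewrite !ge0_integralZl_EFin//; try exact: mpsi; try by move=> w _; rewrite lee_fin.
  apply: (@le_trans _ _ (t%:E * 1 + (1 - t)%:E * 1)%E).
    by apply: leeD; apply: lee_wpmul2l => //; rewrite ?lee_fin.
  by rewrite !mule1 -EFinD subrKC.
have [-> |f1] := eqVneq (Lpsi_norm psi P z1) +oo%E.
  by rewrite addye ?leey// gt_eqF// (lt_le_trans _ (Lpsi_norm_ge0 _))// ltNy0.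
have [-> |f2] := eqVneq (Lpsi_norm psi P z2) +oo%E.
  by rewrite addey ?leey// gt_eqF// (lt_le_trans _ (Lpsi_norm_ge0 _))// ltNy0.
have n1 : Lpsi_norm psi P z1 \is a fin_num.
  by rewrite ge0_fin_numE ?Lpsi_norm_ge0// ltey.
have n2 : Lpsi_norm psi P z2 \is a fin_num.
  by rewrite ge0_fin_numE ?Lpsi_norm_ge0// ltey.
apply/lee_addgt0Pr => e e0; have e2 : 0 < e / 2 by rewrite divr_gt0.
have [_ [c1 [c10 h1] <-] lt1] := lb_ereal_inf_adherent e2 n1.
have [_ [c2 [c20 h2] <-] lt2] := lb_ereal_inf_adherent e2 n2.
apply: le_trans (adm _ _ c10 c20 h1 h2) _.
rewrite [e]splitr EFinD (EFinD (e / 2)) addeACA; apply: leeD; exact: ltW.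
Qed.

Lemma psi_exp_bound : exists2 c, 0 < c & forall u, 0 <= u -> psi u <= c * expR u.
Proof.
have [_ _ _ _ [c1 [c2 [c10 c20 H]]]] := Psi; exists c2 => // u /H[_ h].
by apply: le_trans h _; rewrite ler_pM2l// lerBlDr lerDl.
Qed.

(** Since [psi 0 = 0], convexity gives [psi (u / k) <= psi u / k] for [k >= 1]; the choice
    [k = 1 + c * B] makes [c * B / k] at most 1. *)
Lemma Lpsi_norm_exp (c B sg : R) z :
  (forall u, 0 <= u -> psi u <= c * expR u) -> 0 < c -> 0 < B -> 0 < sg ->
  measurable_fun setT z -> (forall w, 0 <= z w) ->
  (\int[P]_w (expR (z w))%:E <= B%:E)%E ->
  (Lpsi_norm psi P (fun w => (sg * z w)%R) <= (sg * (1 + c * B))%:E)%E.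
Proof.
move=> psiexp c0 B0 sg0 mz z0 zB; set k := 1 + c * B.
have k1 : 1 <= k by rewrite lerDl mulr_ge0// ltW.
have k0 : 0 < k by exact: lt_le_trans k1.
apply: Lpsi_norm_le; first by rewrite mulr_gt0.
apply: (@le_trans _ _ (\int[P]_w ((c / k)%:E * (expR (z w))%:E))%E).
  apply: ge0_le_integral => //.
  - by move=> w _; rewrite lee_fin.
  - by apply: mpsi; exact: measurable_funM.
  - apply/measurable_EFinP/measurable_funM => //.
    by apply: measurableT_comp => //; exact: measurable_expR.
  move=> w _; rewrite -EFinM lee_fin normrM (gtr0_norm sg0) (ger0_norm (z0 w)).
  have -> : sg * z w / (sg * k) = k^-1 * z w + (1 - k^-1) * 0.
    by field; rewrite !gt_eqF.
  apply: le_trans (psi_convex _ _ _) _.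
    by rewrite invr_ge0 (ltW k0)/= invf_le1.
  rewrite psi0 mulr0 addr0 mulrAC [leLHS]mulrC ler_pM2r ?invr_gt0//; exact: psiexp.
have ck : 0 <= c / k by rewrite divr_ge0// ltW.
rewrite ge0_integralZl_EFin//; last first.
  by apply/measurable_EFinP; apply: measurableT_comp => //; exact: measurable_expR.
apply: (@le_trans _ _ ((c / k)%:E * B%:E)%E); first by apply: lee_wpmul2l.
by rewrite -EFinM lee_fin mulrAC ler_pdivrMr// mul1r lerDr.
Qed.

Lemma Lpsi_norm_bounded (c M : R) z :
  (forall u, 0 <= u -> psi u <= c * expR u) -> 0 < c -> 0 < M ->
  measurable_fun setT z -> (forall w, `|z w| <= M) ->
  (Lpsi_norm psi P z <= (M * (1 + c * expR 1))%:E)%E.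
Proof.
move=> psiexp c0 M0 mz zM.
apply: (@le_trans _ _ (Lpsi_norm psi P (fun w => (M * 1)%R))).
  by apply: le_Lpsi_norm => // w; rewrite mulr1 (gtr0_norm M0).
apply: (Lpsi_norm_exp psiexp c0 (expR_gt0 1) M0) => //.
by rewrite integral_cst// [X in (_ * X)%E]probability_setT mule1.
Qed.

Lemma integral_psi_indic (A : set Om) c : measurable A ->
  (\int[P]_w (psi (`|\1_A w : R| / c))%:E = (psi c^-1)%:E * P A)%E.
Proof.
move=> mA; transitivity (\int[P]_w ((psi c^-1)%:E * (\1_A w)%:E))%E.
  apply: eq_integral => w _; rewrite -EFinM indicE.
  by case: (w \in A); rewrite ?normr1 ?normr0 ?mul1r ?mul0r ?psi0 ?mulr1 ?mulr0.
rewrite ge0_integralZl_EFin//.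
  by rewrite integral_indic// setIT.
by apply/measurable_EFinP; exact: measurable_indic.
Qed.

End Orlicz.

(** * Orlicz norm of an indicator *)

Section OrliczIndicator.
Variables (R : realType) (psi : R -> R).
Hypothesis Psi : Psi_class psi.

(** Up to a factor 2 the norm is bounded by [psi_tilde]. As a probability is at most 1, [psi_inv] is
    evaluated at a number at least 1 and is bounded below by [u0]; so one of the two square-root
    factors of [psi_tilde] becomes a constant. *)
Lemma Lpsi_norm_indic : exists2 K : R, 0 < K &
  forall d (Om : measurableType d) (P : probability Om R) (A : set Om), measurable A ->
  (Lpsi_norm psi P (\1_A : Om -> R) <= (K * Num.sqrt (psi_tilde psi (fine (P A))))%:E)%E.
Proof.
have [_ _ [psi_ge0 psi0] psi_homo [c1 [c2 [c10 c20 H]]]] := Psi.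
(* The solution of [c2 * (expR u - 1) = 1], so that [psi u0 <= 1]. *)
pose u0 := ln (1 + c2^-1).
have u00 : 0 < u0 by rewrite ln_gt0// ltrDl invr_gt0.
have psiu0 : psi u0 <= 1.
  have [_ h] := H u0 (ltW u00); apply: le_trans h _.
  by rewrite lnK ?posrE ?addr_gt0 ?invr_gt0// addrC addKr mulfV ?gt_eqF.
exists (2 / Num.sqrt u0); first by rewrite divr_gt0// sqrtr_gt0.
move=> d Om P A mA.
have PAf : P A \is a fin_num by exact: fin_num_measure.
set p := fine (P A); have PAE : P A = p%:E by rewrite fineK.
have p_ge0 : 0 <= p by rewrite -lee_fin -PAE.
have p_le1 : p <= 1 by rewrite -lee_fin -PAE probability_le1.
rewrite /psi_tilde; have [p0|p0] := leP p 0.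
  have {}p0 : p = 0 by apply/eqP; rewrite eq_le p0.
  rewrite sqrtr0 mulr0; apply/lee_addgt0Pr => e e0; rewrite add0e.
  apply: Lpsi_norm_le => //.
  by rewrite integral_psi_indic// PAE p0 mule0 lee_fin.
set S := [set u : R | 0 <= u /\ psi u <= p^-1].
have p1 : 1 <= p^-1 by rewrite invf_ge1.
have Su0 : S u0 by split; [exact: ltW|exact: le_trans p1].
have hS : has_sup S.
  split; first by exists u0.
  exists (p^-1 / c1) => u [u_ge0 psiu]; have [h _] := H _ u_ge0.
  by rewrite ler_pdivlMr// mulrC (le_trans h).
rewrite /psi_inv -/S; set u := sup S.
have u0u : u0 <= u by apply: ub_le_sup => //; exact: hS.2.
have u_gt0 : 0 < u by exact: lt_le_trans u0u.
(* Half the supremum lies below some element of [S], whether or not the supremum is attained; this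
   is the source of the factor 2. *)
have [|x [x0 psix] ux] := sup_adherent (_ : 0 < u / 2) hS; first by rewrite divr_gt0.
have psiu : psi (u / 2) <= p^-1.
  apply: le_trans psix; apply: psi_homo; first by rewrite divr_ge0// ltW.
  by move: ux; rewrite -/u => ux; lra.
apply: (@le_trans _ _ (u / 2)^-1%:E).
  apply: Lpsi_norm_le; first by rewrite invr_gt0 divr_gt0.
  rewrite integral_psi_indic// invrK PAE -EFinM lee_fin.
  by rewrite -ler_pdivlMr// mul1r.
rewrite lee_fin.
have ru : 0 < Num.sqrt u by rewrite sqrtr_gt0.
have ru0 : 0 < Num.sqrt u0 by rewrite sqrtr_gt0.
have -> : Num.sqrt u^-1 = (Num.sqrt u)^-1 by rewrite sqrtrV// ltW.
have -> : (u / 2)^-1 = 2 * (Num.sqrt u)^-1 * (Num.sqrt u)^-1.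
  rewrite -{1}(@sqr_sqrtr _ u) ?ltW//; field; rewrite gt_eqF//.
rewrite ler_pM2r ?invr_gt0// ler_pM2l// lef_pV2 ?posrE//.
by rewrite ler_sqrt// ltW.
Qed.

End OrliczIndicator.

(** * Orlicz norms of powers controlled by second moments *)

Section GaussianMoments.
Variables (R : realType) (psi : R -> R).
Hypothesis Psi : Psi_class psi.

Lemma powR_le1D (y a : R) : 0 <= y -> 0 <= a <= 1 -> y `^ a <= 1 + y.
Proof.
move=> y0 /andP[a0 a1]; have [y1|y1] := leP y 1.
  apply: (@le_trans _ _ 1); last by rewrite lerDl.
  by have := ge0_ler_powR a0 _ _ y1; rewrite powR1; apply; rewrite nnegrE.
apply: (@le_trans _ _ (y `^ 1)); last by rewrite powRr1// lerDr.
by rewrite ler_powR// ltW.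
Qed.

(** [N^r] is a multiple of [(N^2 / (k v))^(r/2)], which for [r <= 2] is at most [1 + N^2 / (k v)],
    and Fernique's inequality bounds the expected exponential of the latter. The constant is chosen
    before the probability space and the variables. *)
Lemma Lpsi_norm_gaussian (r : R) : 0 < r -> r <= 2 -> exists2 C : R, 0 < C &
  forall d (Om : measurableType d) (Q : probability Om R) (V : set (Om -> R))
    (U : nat -> Om -> R) (N : Om -> R),
  gaussian_space Q V -> (forall k, V (U k)) ->
  (forall w t, N w <= t <-> forall k, `|U k w| <= t) ->
  (Lpsi_norm psi Q (fun w => (N w `^ r)%R) <=
   C%:E * poweR (poweR (\int[Q]_w ((N w ^+ 2)%R)%:E) (2^-1)%R) r)%E.
Proof.
move=> r0 r2; have [c c0 psiexp] := psi_exp_bound Psi.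
pose k : R := 25 * (1 + expR 2).
have k0 : 0 < k by rewrite mulr_gt0// addr_gt0// expR_gt0.
pose B : R := expR 1 * (expR 1 + 1).
have B0 : 0 < B by rewrite mulr_gt0 ?addr_gt0 ?expR_gt0.
pose C := (k `^ 2^-1) `^ r * (1 + c * B).
have C0 : 0 < C by rewrite mulr_gt0 ?powR_gt0// addr_gt0// mulr_gt0.
exists C => // d Om Q V U N gV VU NU.
have N0 := norming_ge0 NU; have mN := measurable_norming gV VU NU.
have key v : 0 < v -> (\int[Q]_w ((N w ^+ 2)%R)%:E <= v%:E)%E ->
    (Lpsi_norm psi Q (fun w => (N w `^ r)%R) <= (C * (v `^ 2^-1) `^ r)%:E)%E.
  move=> v0 Nv; have := fernique gV VU NU v0 Nv.
  rewrite mulrA -/k => F.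
  have kv : 0 < k * v by rewrite mulr_gt0.
  pose z w := (N w ^+ 2 / (k * v)) `^ (r / 2).
  have y0 w : 0 <= N w ^+ 2 / (k * v) by rewrite divr_ge0 ?sqr_ge0 ?ltW.
  have my : measurable_fun setT (fun w => N w ^+ 2 / (k * v)).
    by apply: measurable_funM => //; exact: measurable_funX.
  have mz : measurable_fun setT z.
    exact: (measurableT_comp (measurable_powR _) my).
  have sg0 : 0 < (k * v) `^ (r / 2) by exact: powR_gt0.
  have zB : (\int[Q]_w (expR (z w))%:E <= B%:E)%E.
    apply: (@le_trans _ _ (\int[Q]_w ((expR 1)%:E * (expR (N w ^+ 2 / (k * v)))%:E))%E).
      apply: ge0_le_integral => //.
      - apply/measurable_EFinP; apply: measurableT_comp => //; exact: measurable_expR.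
      - apply/measurable_EFinP/measurable_funM => //.
        by apply: measurableT_comp => //; exact: measurable_expR.
      move=> w _; rewrite -EFinM lee_fin -expRD ler_expR powR_le1D//.
      by apply/andP; split; [rewrite divr_ge0// ltW|rewrite ler_pdivrMr// mul1r].
    rewrite ge0_integralZl_EFin ?expR_ge0//; last first.
      by apply/measurable_EFinP; apply: measurableT_comp => //; exact: measurable_expR.
    by rewrite /B EFinM; apply: lee_wpmul2l => //; rewrite lee_fin expR_ge0.
  have z0 w : 0 <= z w by exact: powR_ge0.
  have := @Lpsi_norm_exp _ _ _ Q _ Psi c B _ z psiexp c0 B0 sg0 mz z0 zB.
  congr (_ <= _)%E.
    congr Lpsi_norm; apply/funext => w; rewrite /z -(powRM _ (ltW kv) (y0 w)).
    rewrite mulrCA mulfV ?gt_eqF// mulr1 -powR_mulrn// -powRrM; congr (_ `^ _).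
    by field.
  congr EFin; rewrite /C -!powRrM [2^-1 * r]mulrC (powRM _ (ltW k0) (ltW v0)); ring.
have I0 : (0 <= \int[Q]_w ((N w ^+ 2)%R)%:E)%E.
  by apply: integral_ge0 => w _; rewrite lee_fin sqr_ge0.
have [Ioo|Ioo] := eqVneq (\int[Q]_w ((N w ^+ 2)%R)%:E)%E +oo%E.
  by rewrite Ioo !poweRyr ?gt_eqF ?invr_gt0// gt0_muley ?lte_fin// leey.
have If : (\int[Q]_w ((N w ^+ 2)%R)%:E)%E \is a fin_num by rewrite ge0_fin_numE// ltey.
move: If I0 key {Ioo} => /fineK <-; set v := fine _; rewrite lee_fin => v0 key.
rewrite !poweR_EFin -EFinM.
move: v0; rewrite le_eqVlt => /predU1P[v0|v0]; last exact: key.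
rewrite -v0 !powR0 ?gt_eqF ?invr_gt0// mulr0.
apply/lee_addgt0Pr => e e0; rewrite add0e.
(* Fernique's inequality takes a positive bound, so a zero second moment is approached from above:
   [v'] solves [C * v'^(r/2) = e]. *)
pose v' := (e / C) `^ (r^-1 * 2).
have eC : 0 < e / C by rewrite divr_gt0.
have v'0 : 0 < v' by rewrite powR_gt0.
have := key v' v'0; rewrite -v0 lee_fin => /(_ (ltW v'0)).
rewrite /v' -!powRrM.
have -> : r^-1 * 2 * (2^-1 * r) = 1 by field; rewrite gt_eqF.
by rewrite (powRr1 (ltW eC)) mulrC divfK ?gt_eqF.
Qed.

End GaussianMoments.

(** * Borel maps and the Gaussian space of the dual functionals *)

Section BorelMaps.
Variables (R : realType) (E : normedModType R).

Lemma borel_fun_continuous (f : E -> R) : continuous f -> borel_fun f.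
Proof.
move=> fc.
pose T : measurableType _ := g_sigma_algebraType [set O : set E | open O].
suff mf : measurable_fun (setT : set T) (f : T -> R).
  by move=> B mB; have := mf measurableT B mB; rewrite setTI.
move=> mT; apply: (measurability _ (RGenOInfty.measurableE R)) => // _ [_ [x ->] <-].
rewrite setTI; apply: sub_sigma_algebra => /=.
by move/continuousP : fc; apply; exact: interval_open.
Qed.

Lemma borelE_preimage (phi : E -> E) (A : set E) : continuous phi ->
  borelE A -> borelE (phi @^-1` A).
Proof.
move=> pc; pose T : measurableType _ := g_sigma_algebraType [set O : set E | open O].
have TE : @measurable _ T = <<s [set O : set E | open O] >> by [].
suff mphi : measurable_fun (setT : set T) (phi : T -> T).
  by move=> bA; have := mphi measurableT A bA; rewrite setTI.
move=> mT; apply: (measurability _ TE) => // _ [W oW <-].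
rewrite setTI; apply: sub_sigma_algebra => /=.
by move/continuousP : pc; apply.
Qed.

Context d (Om : measurableType d).

Lemma measurable_borel_comp (f : E -> R) (X : Om -> E) :
  borel_fun f -> measE X -> measurable_fun setT (fun w => f (X w)).
Proof.
by move=> bf mX _ B mB; rewrite setTI; apply: (mX (f @^-1` B)); exact: bf.
Qed.

Lemma measE_affine (X : Om -> E) (y : E) (a : R) : measE X ->
  measE (fun w => y + a *: X w).
Proof.
move=> mX A bA; apply: (mX ((fun x => y + a *: x) @^-1` A)).
apply: borelE_preimage => // x.
by apply: cvgD; [exact: cvg_cst|apply: cvgZ; [exact: cvg_cst|exact: cvg_id]].
Qed.

Lemma cont_dual_continuous (u : E -> R) : @cont_dual _ E u -> continuous u.
Proof.
move=> [ul [K uK]] x; apply/cvgrPdist_lt => e e0.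
have K0 : 0 < `|K| + 1 by rewrite ltr_wpDl.
near=> y; rewrite -linfunB// (le_lt_trans (uK _))//.
apply: (@le_lt_trans _ _ ((`|K| + 1) * `|x - y|)).
  by rewrite ler_wpM2r// (le_trans (ler_norm K))// lerDl.
rewrite -ltr_pdivlMl//; near: y.
apply/nbhs_normP; exists ((`|K| + 1)^-1 * e) => //=.
by rewrite mulr_gt0 ?invr_gt0.
Unshelve. all: end_near. Qed.

Lemma gaussian_space_dual (Q : probability Om R) (X : Om -> E) :
  centered_gaussian Q X ->
  gaussian_space Q [set v | exists2 u, @cont_dual _ E u & v = u \o X].
Proof.
move=> [mX gX]; split=> [a b _ _ [u [ul [K uK]] ->] [v [vl [L vL]] ->]|_ [u du ->]].
  exists (fun x => a * u x + b * v x) => //; split.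
    by move=> c x y; rewrite ul vl; ring.
  exists (`|a| * K + `|b| * L) => x.
  rewrite (le_trans (ler_normD _ _))// !normrM mulrDl -!mulrA.
  by apply: lerD; rewrite ler_wpM2l.
split; last exact: gX.
apply: measurable_borel_comp => //; apply: borel_fun_continuous.
exact: cont_dual_continuous.
Qed.

End BorelMaps.

Lemma dual_ball_cont_dual (R : realType) (E : normedModType R) (u : E -> R) :
  @dual_ball _ E u -> @cont_dual _ E u.
Proof. by move=> [ul u1]; split => //; exists 1 => x; rewrite mul1r. Qed.

(** * First-order Taylor expansion with a Hölder derivative *)

Section Taylor.
Variables (R : realType) (E : normedModType R).
Implicit Types (f : E -> R) (x h : E).

Lemma is_derive_line f x h (t : R) : differentiable f (x + t *: h) ->
  is_derive t 1 (fun r : R => f (x + r *: h)) ('d f (x + t *: h) h).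
Proof.
move=> df; set a := x + t *: h.
have quotE : (fun k : R => k^-1 *: (((fun r : R => f (x + r *: h)) \o shift t) (k *: 1) -
    f (x + t *: h))) = (fun k => k^-1 *: ((f \o shift a) (k *: h) - f a)).
  apply/funext => k /=; congr (_ *: (f _ - _)).
  have -> : k *: (1 : R) = k by rewrite /GRing.scale/= mulr1.
  by rewrite scalerDl addrCA.
split; first by rewrite /derivable quotE; exact: diff_derivable.
by rewrite /derive quotE -(deriveE h df).
Qed.

Lemma diff_norm_le f x (e : R) : differentiable f x -> 0 < e ->
  (forall y, `|y - x| < e -> `|f y - f x| <= `|y - x|) ->
  forall h, `|'d f x h| <= `|h|.
Proof.
move=> df e0 lip.
have le h : 'd f x h <= `|h|.
  rewrite -(deriveE h df) /derive; apply: limr_le; first exact: diff_derivable.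
  near=> k.
  have k0 : k != 0 by near: k; exact: nbhs_dnbhs_neq.
  have kh : `|k *: h| < e.
    rewrite normrZ; apply: (@le_lt_trans _ _ (`|k| * (`|h| + 1))).
      by rewrite ler_wpM2l// lerDl.
    rewrite -ltr_pdivlMr ?ltr_wpDl//; near: k.
    by apply: dnbhs0_lt; rewrite divr_gt0// ltr_wpDl.
  have := lip (k *: h + x); rewrite addrK => /(_ kh) H.
  rewrite (le_trans (ler_norm _))// normrZ normfV ler_pdivrMl ?normr_gt0//.
  by rewrite -normrZ.
move=> h; rewrite ler_norml le andbT lerNl.
by have := le (- h); rewrite linearN normrN.
Unshelve. all: end_near. Qed.

(** On the segment the mean value theorem writes the increment as ['d f] at an intermediate point,
    and the Hölder condition compares this with ['d f x]. *)
Lemma taylor_holder (rho e : R) f x : 0 < rho ->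
  (forall y, `|y - x| < e -> differentiable f y) ->
  (forall y h, `|y - x| < e -> y <> x ->
    `|'d f y h - 'd f x h| <= `|y - x| `^ rho * `|h|) ->
  forall h, `|h| < e -> `|f (x + h) - f x - 'd f x h| <= `|h| `^ (1 + rho).
Proof.
move=> rho0 df dh h he.
have inball (t : R) : 0 <= t <= 1 -> `|x + t *: h - x| < e.
  move=> /andP[t0 t1]; rewrite addrC addKr normrZ ger0_norm//.
  by apply: le_lt_trans he; rewrite ler_piMl.
have [c c01] : exists2 c, c \in `]0, 1[%R &
    f (x + 1 *: h) - f (x + 0 *: h) = 'd f (x + c *: h) h * (1 - 0).
  apply: (@MVT R (fun t => f (x + t *: h)) (fun t => 'd f (x + t *: h) h)) => //.
    move=> t; rewrite in_itv/= => /andP[t0 t1].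
    by apply: is_derive_line; apply/df/inball; rewrite !ltW.
  apply: derivable_within_continuous => t; rewrite in_itv/= => t01.
  have [] // := is_derive_line (df _ (inball t t01)).
rewrite scale1r scale0r addr0 subr0 mulr1 => ->.
move: c01; rewrite in_itv/= => /andP[c0 c1].
have [->|xc] := pselect (x + c *: h = x); first by rewrite subrr normr0 powR_ge0.
have c01 : 0 <= c <= 1 by rewrite !ltW.
apply: le_trans (dh _ h (inball c c01) xc) _.
have h0 : 0 < `|h|.
  by rewrite normr_gt0; apply/eqP => h0; apply: xc; rewrite h0 scaler0 addr0.
rewrite powRD ?(gt_eqF h0) ?implybT// powRr1// [leRHS]mulrC ler_pM2r//.
rewrite addrC addKr normrZ (gtr0_norm c0).
have cpos := ltW c0; apply: ge0_ler_powR; rewrite ?nnegrE ?mulr_ge0 ?(ltW rho0)//.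
by rewrite ler_piMl// ltW.
Qed.

End Taylor.

(** * Gaussian bounds in a Banach space and transfer between estimators *)

Section BanachGaussian.
Variables (R : realType) (psi : R -> R).
Hypothesis Psi : Psi_class psi.

Lemma cont_dual_scale (E : normedModType R) (a : R) (u : E -> R) :
  @cont_dual _ E u -> @cont_dual _ E (fun x => u (a *: x)).
Proof.
move=> [ul [K uK]]; split=> [b x y|].
  by rewrite scalerDr scalerA mulrC -scalerA ul.
by exists (K * `|a|) => x; rewrite -mulrA -normrZ.
Qed.

Lemma integral_scaled_sqr d (Om : measurableType d) (Q : probability Om R)
    (a : R) (N : Om -> R) : measurable_fun setT N ->
  (\int[Q]_w (((a * N w) ^+ 2)%R)%:E = (a ^+ 2)%:E * \int[Q]_w ((N w ^+ 2)%R)%:E)%E.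
Proof.
move=> mN; under eq_integral do rewrite exprMn EFinM.
rewrite ge0_integralZl_EFin ?sqr_ge0//.
- by move=> w _; rewrite lee_fin sqr_ge0.
- by apply/measurable_EFinP; exact: measurable_funX.
Qed.

Lemma measurable_norm_measE (E : normedModType R) d (Om : measurableType d)
  (X : Om -> E) : measE X -> measurable_fun setT (fun w => `|X w|).
Proof.
move=> mX; apply: (measurable_borel_comp (f := fun x : E => `|x|)) => //.
by apply: borel_fun_continuous; exact: norm_continuous.
Qed.

(** The scaling by [a] is absorbed into the norming functionals, which stay in the Gaussian space of
    [X]. *)
Lemma Lpsi_norm_gaussian_norm (r : R) : 0 < r -> r <= 2 -> exists2 C : R, 0 < C &
  forall (E : normedModType R) d (Om : measurableType d) (Q : probability Om R)
    (X : Om -> E) (a : R), separable E -> centered_gaussian Q X ->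
  (Lpsi_norm psi Q (fun w => (`|a *: X w| `^ r)%R) <=
   C%:E * poweR (poweR ((a ^+ 2)%:E * \int[Q]_w ((`|X w| ^+ 2)%R)%:E) (2^-1)%R) r)%E.
Proof.
move=> r0 r2; have [C C0 H] := Lpsi_norm_gaussian Psi r0 r2.
exists C => // E d Om Q X a sE gX.
have [u du un] := norming_sequence sE.
have mX := measurable_norm_measE gX.1.
have := H _ Om Q _ (fun k w => u k (a *: X w)) (fun w => `|a *: X w|)
  (gaussian_space_dual gX).
have -> : (\int[Q]_w ((`|a *: X w| ^+ 2)%R)%:E =
    (a ^+ 2)%:E * \int[Q]_w ((`|X w| ^+ 2)%R)%:E)%E.
  under eq_integral do rewrite normrZ.
  by rewrite integral_scaled_sqr// -normrX ger0_norm ?sqr_ge0.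
apply=> [k|w t]; last exact: un.
exists (fun x => u k (a *: x)) => //.
by apply: cont_dual_scale; exact: dual_ball_cont_dual.
Qed.

(** The case of a constant norming sequence and exponent 1. *)
Lemma Lpsi_norm_gaussian_dual : exists2 C : R, 0 < C &
  forall (E : normedModType R) d (Om : measurableType d) (Q : probability Om R)
    (X : Om -> E) (u : E -> R) (a : R), 0 < a -> @dual_ball _ E u ->
    centered_gaussian Q X ->
  (Lpsi_norm psi Q (fun w => u (a *: X w)) <=
   C%:E * (poweR (\int[Q]_w (u (X w) * u (X w))%:E) (2^-1)%R * a%:E))%E.
Proof.
have [C C0 H] := Lpsi_norm_gaussian Psi ltr01 (ler1n R 2).
exists C => // E d Om Q X u a a0 du gX.
have cu := dual_ball_cont_dual du.
have cuX := cont_dual_scale a cu.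
have muX : measurable_fun setT (fun w => u (X w)).
  apply: measurable_borel_comp gX.1.
  by apply: borel_fun_continuous; exact: cont_dual_continuous.
have muaX : measurable_fun setT (fun w => u (a *: X w)).
  apply: (measurable_borel_comp (f := fun x => u (a *: x))) gX.1.
  by apply: borel_fun_continuous; exact: cont_dual_continuous.
have uZ x : u (a *: x) = a * u x.
  by have := du.1 a x 0; rewrite linfun0 ?addr0//; exact: du.1.
have := H _ Om Q _ (fun _ w => u (a *: X w)) (fun w => `|u (a *: X w)|)
  (gaussian_space_dual gX).
have -> : (\int[Q]_w ((`|u (a *: X w)| ^+ 2)%R)%:E =
    (a ^+ 2)%:E * \int[Q]_w (u (X w) * u (X w))%:E)%E.
  under eq_integral do rewrite real_normK ?num_real// uZ.
  by rewrite integral_scaled_sqr//; under [in RHS]eq_integral do rewrite -expr2.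
rewrite poweRM ?lee_fin ?sqr_ge0//; last first.
  by apply: integral_ge0 => w _; rewrite lee_fin -expr2 sqr_ge0.
rewrite poweR_EFin powR12_sqrt ?sqr_ge0// sqrtr_sqr gtr0_norm// [(a%:E * _)%E]muleC poweRe1; last first.
  by rewrite mule_ge0 ?poweR_ge0// lee_fin ltW.
move=> H'; apply: (le_trans _ (H' _ _)) => [|k|w t].
- apply: le_Lpsi_norm => // [|w].
    by apply: (measurableT_comp (measurable_powR _)); exact: measurableT_comp.
  by rewrite powRr1// normr_id.
- by exists (fun x => u (a *: x)).
- by split=> [|/(_ 0%N)].
Qed.

(** Halving keeps [f - f y] bounded by 1; the factor 2 comes back through the triangle inequality,
    hence the repeated summand. *)
Lemma Lpsi_norm_transfer (E : normedModType R) d (Om : measurableType d)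
    (P : probability Om R) d' (Om' : measurableType d') (Q : probability Om' R)
    (F1 : Om -> E) (F2 : Om' -> E) (f : E -> R) (y : E) (D : \bar R)
    (g := fun x => 2^-1 * (f x - f y)) :
  measE F1 -> measE F2 -> borel_fun f -> (forall x, `|f x| <= 1) ->
  (`| Lpsi_norm psi P (fun w => g (F1 w)) - Lpsi_norm psi Q (fun w => g (F2 w)) | <= D)%E ->
  (Lpsi_norm psi P (fun w => (f (F1 w) - f y)%R) <=
   (Lpsi_norm psi Q (fun w => (f (F2 w) - f y)%R) + D) +
   (Lpsi_norm psi Q (fun w => (f (F2 w) - f y)%R) + D))%E.
Proof.
move=> m1 m2 bf f1 gD.
have [c c0 psiexp] := psi_exp_bound Psi.
have mf1 : measurable_fun setT (fun w => f (F1 w) - f y).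
  by apply: measurable_funB => //; exact: measurable_borel_comp.
have mf2 : measurable_fun setT (fun w => f (F2 w) - f y).
  by apply: measurable_funB => //; exact: measurable_borel_comp.
have mg1 : measurable_fun setT (fun w => g (F1 w)) by exact: measurable_funM.
have mg2 : measurable_fun setT (fun w => g (F2 w)) by exact: measurable_funM.
have h0 : 0 <= 2^-1 :> R by rewrite invr_ge0.
have g1 x : `|g x| <= 1.
  rewrite /g normrM ger0_norm//.
  have := ler_normB (f x) (f y); have := f1 x; have := f1 y; lra.
(* Boundedness of [g] makes both norms finite, so that the bound on their extended-real difference
   can be turned into a bound on one by the other. *)
have L1 := Lpsi_norm_bounded P Psi psiexp c0 ltr01 mg1 (fun w => g1 _).
have L2 := Lpsi_norm_bounded Q Psi psiexp c0 ltr01 mg2 (fun w => g1 _).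
have n1 : Lpsi_norm psi P (fun w => g (F1 w)) \is a fin_num.
  by rewrite ge0_fin_numE ?Lpsi_norm_ge0// (le_lt_trans L1)// ltry.
have n2 : Lpsi_norm psi Q (fun w => g (F2 w)) \is a fin_num.
  by rewrite ge0_fin_numE ?Lpsi_norm_ge0// (le_lt_trans L2)// ltry.
have half : (Lpsi_norm psi P (fun w => g (F1 w)) <=
    Lpsi_norm psi Q (fun w => (f (F2 w) - f y)%R) + D)%E.
  apply: (@le_trans _ _ (Lpsi_norm psi Q (fun w => g (F2 w)) + D)%E).
    by rewrite addeC -leeBlDr// (le_trans _ gD)// lee_abs.
  rewrite leeD2r//; apply: le_Lpsi_norm => // w.
  by rewrite /g normrM ger0_norm// ler_piMl// invf_le1// ler1n.
apply: le_trans (leeD half half).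
apply: Lpsi_norm_triangle => // w.
have -> : f (F1 w) - f y = g (F1 w) + g (F1 w) by rewrite /g; field.
exact: ler_normD.
Qed.

Lemma borel_fun_half (E : normedModType R) (f : E -> R) (c : R) :
  borel_fun f -> borel_fun (fun x => 2^-1 * (f x - c)).
Proof.
move=> bf B mB; have mphi : measurable_fun setT (fun x : R => 2^-1 * (x - c)).
  by apply: measurable_funM => //; exact: measurable_funB.
by apply: (bf ((fun x : R => 2^-1 * (x - c)) @^-1` B)); rewrite -[X in measurable X]setTI; exact: mphi.
Qed.

End BanachGaussian.

(** * The two bounds for functionals of the estimator *)

Section FunctionalBounds.
Variables (R : realType) (psi : R -> R).
Hypothesis Psi : Psi_class psi.

Lemma le_mule_poweR_vxi (E : normedModType R) d' (Om' : measurableType d')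
    (Q : probability Om' R) (xi : E -> Om' -> E) (Th : set E) (n : nat) (th : E) (s : R) :
  0 <= s -> Th th -> (0 < n)%N ->
  (poweR (poweR ((((Num.sqrt n%:R)^-1 ^+ 2)%R)%:E *
      \int[Q]_w ((`|xi th w| ^+ 2)%R)%:E) (2^-1)%R) s <=
   poweR (poweR (v_xi Q xi Th * ((n%:R)^-1)%R%:E) (2^-1)%R) s)%E.
Proof.
move=> s0 Tth n0.
have I0 : (0 <= \int[Q]_w ((`|xi th w| ^+ 2)%R)%:E)%E.
  by apply: integral_ge0 => w _; rewrite lee_fin sqr_ge0.
have Iv : (\int[Q]_w ((`|xi th w| ^+ 2)%R)%:E <= v_xi Q xi Th)%E.
  by apply: ereal_sup_ubound; exists th.
have v0 := le_trans I0 Iv.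
rewrite exprVn sqr_sqrtr ?ler0n// muleC.
have nV : (0 <= ((n%:R)^-1 : R)%:E)%E by rewrite lee_fin invr_ge0.
apply: gt0_ler_poweR; rewrite ?in_itv/= ?poweR_ge0 ?leey//.
by apply: gt0_ler_poweR; rewrite ?in_itv/= ?mule_ge0 ?leey//; apply: lee_wpmul2r.
Qed.

Lemma Delta_psi_ub (E : normedModType R) d (Om : measurableType d)
    d' (Om' : measurableType d') (H : set (E -> R)) (Th : set E)
    (P : E -> probability Om R) (thhat : Om -> E) (Q : probability Om' R)
    (xi : E -> Om' -> E) (n : nat) (th : E) (g : E -> R) : Th th -> H g ->
  (`| Lpsi_norm psi (P th) (fun w => g (thhat w)) -
      Lpsi_norm psi Q (fun w => g (gapprox xi n th w)) | <=
   Delta_psi psi H Th P thhat Q xi n)%E.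
Proof. by move=> Tth Hg; apply: ereal_sup_ubound; exists th, g. Qed.

Lemma lipschitz_bound (s : R) : 0 < s -> s <= 1 -> exists2 C : R, 0 < C &
  forall (E : completeNormedModType R) (T Th : set E)
     (d : measure_display) (Om : measurableType d)
     (P : E -> probability Om R) (thhat : Om -> E)
     (d' : measure_display) (Om' : measurableType d')
     (Q : probability Om' R) (xi : E -> Om' -> E) (n : nat),
   separable E -> Th `<=` T -> measE thhat ->
   (forall th, T th -> centered_gaussian Q (xi th)) -> (0 < n)%N ->
   forall (f : E -> R) (th : E), holder_ball s setT f -> Th th ->
   (Lpsi_norm psi (P th) (fun w => (f (thhat w) - f th)%R) <=
     C%:E * (poweR (poweR (v_xi Q xi Th * ((n%:R)^-1)%R%:E) (2^-1)%R) s%R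
             + Delta_psi psi (holder_ball s setT) Th P thhat Q xi n))%E.
Proof.
move=> s0 s1.
have [C0 C00 HC] := Lpsi_norm_gaussian_norm Psi s0 (le_trans s1 (ler1n R 2)).
have C0ge := ltW C00.
exists (C0 + 1 + (C0 + 1)); first by rewrite !addr_gt0.
move=> E T Th d Om P thhat d' Om' Q xi n sE ThT mh gxi n0 f th [bf f1 +] Tth.
rewrite s1 => -[_ fH].
have gx := gxi _ (ThT _ Tth).
have mt : measE (gapprox xi n th) by apply: measE_affine; exact: gx.1.
set D := Delta_psi _ _ _ _ _ _ _ _.
have gball : holder_ball s setT (fun x => 2^-1 * (f x - f th)).
  split; first exact: borel_fun_half.
    move=> x; rewrite normrM ger0_norm ?invr_ge0//.
    have := ler_normB (f x) (f th); have := f1 x; have := f1 th; lra.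
  rewrite s1; split.
    move=> x _; rewrite normrM ger0_norm ?invr_ge0//.
    have := ler_normB (f x) (f th); have := f1 x; have := f1 th; lra.
  move=> x y _ _ xy; rewrite -mulrBr opprB addrA subrK normrM ger0_norm ?invr_ge0//.
  apply: le_trans (fH x y I I xy).
  by rewrite ler_piMl// invf_le1// ler1n.
have gD := Delta_psi_ub P thhat Q xi n Tth gball.
have D0 : (0 <= D)%E by exact: le_trans (abse_ge0 _) gD.
apply: le_trans (Lpsi_norm_transfer Psi mh mt bf f1 gD) _.
set X := poweR _ s.
have X0 : (0 <= X)%E by exact: poweR_ge0.
have step : (Lpsi_norm psi Q (fun w => (f (gapprox xi n th w) - f th)%R) + D <=
    (C0 + 1)%:E * (X + D))%E.
  have XD : (0 <= X + D)%E by exact: adde_ge0.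
  rewrite EFinD ge0_muleDl ?lee_fin// mul1e; apply: leeD; last by rewrite leeDr.
  apply: (@le_trans _ _ (C0%:E * X)%E); last first.
    by apply: lee_wpmul2l; rewrite ?lee_fin ?(ltW C00)// leeDl.
  apply: (@le_trans _ _ (Lpsi_norm psi Q
      (fun w => (`|(Num.sqrt n%:R)^-1 *: xi th w| `^ s)%R))).
    apply: le_Lpsi_norm => //.
    - by apply: measurable_funB => //; exact: measurable_borel_comp.
    - apply: (measurableT_comp (measurable_powR _)).
      under eq_fun do rewrite normrZ.
      by apply: measurable_funM => //; exact: measurable_norm_measE gx.1.
    move=> w; rewrite /gapprox [leRHS]ger0_norm ?powR_ge0//.
    set h := _ *: _; have [->|hth] := pselect (th + h = th).
      by rewrite subrr normr0 powR_ge0.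
    by have := fH _ _ I I hth; rewrite [th + h - th]addrAC subrr add0r.
  apply: le_trans (HC E _ _ Q _ (Num.sqrt n%:R)^-1 sE gx) _.
  apply: lee_wpmul2l; rewrite ?lee_fin ?(ltW C00)//.
  by apply: le_mule_poweR_vxi => //; exact: ltW.
rewrite EFinD ge0_muleDl ?lee_fin ?addr_ge0//; first exact: leeD.
Qed.

Lemma smooth_bound (rho : R) : 0 < rho -> rho <= 1 -> exists2 C : R, 0 < C &
  forall (E : completeNormedModType R) (T Th : set E)
     (d : measure_display) (Om : measurableType d)
     (P : E -> probability Om R) (thhat : Om -> E)
     (d' : measure_display) (Om' : measurableType d')
     (Q : probability Om' R) (xi : E -> Om' -> E) (n : nat) (del : R),
   separable E -> Th `<=` T -> measE thhat ->
   (forall th, T th -> centered_gaussian Q (xi th)) ->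
   (0 < n)%N -> 0 < del -> enlarge Th del `<=` T ->
   forall (f : E -> R) (th : E),
   holder_ball (1 + rho) (enlarge Th del) f -> Th th ->
   (Lpsi_norm psi (P th) (fun w => (f (thhat w) - f th)%R) <=
     C%:E * Order.min
       (poweR (Sigma_norm Q xi Th) (2^-1)%R * ((Num.sqrt n%:R)^-1)%R%:E
        + poweR (poweR (v_xi Q xi Th * ((n%:R)^-1)%R%:E) (2^-1)%R) (1 + rho)%R
        + Delta_exp (holder_ball (1 + rho)%R (enlarge Th (2^-1 * del)%R))
                    (enlarge Th del) P thhat Q xi n
        + Delta_psi psi (holder_ball (1 + rho)%R (enlarge Th (2^-1 * del)%R))
                    (enlarge Th del) P thhat Q xi n
        + ereal_sup [set (Num.sqrt (psi_tilde psi
              (fine (Q [set w | (2^-1 * del * Num.sqrt n%:R <= `|xi th' w|)%R]))))%:E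
            | th' in Th])
       1)%E.
Proof.
move=> rho0 rho1.
have rho20 : 0 < 1 + rho by rewrite addr_gt0.
have rho22 : 1 + rho <= 2 by lra.
have [C1 C10 HC1] := Lpsi_norm_gaussian_norm Psi rho20 rho22.
have [C2 C20 HC2] := Lpsi_norm_gaussian_dual Psi.
have [K K0 HK] := Lpsi_norm_indic Psi.
have [c c0 psiexp] := psi_exp_bound Psi.
have [C1ge C2ge Kge] : [/\ 0 <= C1, 0 <= C2 & 0 <= K] by split; exact: ltW.
(* One constant each for the linear term, the Taylor remainder, two copies of the indicator, and the
   distance. *)
pose C := C2 + (C1 + (K + K)) + 1.
have Cp : 0 < C by rewrite !addr_gt0.
(* [C + C] serves when the bracket is at most 1; otherwise the last summand does, bounding the norm
   of a function with values in [[-2, 2]]. *)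
exists (C + C + 2 * (1 + c * expR 1)).
  by rewrite !addr_gt0// mulr_gt0// addr_gt0// mulr_gt0// expR_gt0.
move=> E T Th d Om P thhat d' Om' Q xi n del sE ThT mh gxi n0 del0 TdT f th [bf f1 +] Tth.
rewrite ifF; last by apply/negbTE; rewrite -ltNge ltrDl.
rewrite addrAC subrr add0r => -[fd _ fL fH].
have gx := gxi _ (ThT _ Tth).
set a := (Num.sqrt n%:R)^-1 : R.
have a0 : 0 < a by rewrite invr_gt0 sqrtr_gt0 ltr0n.
have mt : measE (gapprox xi n th) by apply: measE_affine; exact: gx.1.
have mnorm := measurable_norm_measE gx.1.
have inTd y : `|y - th| < del -> enlarge Th del y by exists th.
have Tdth : enlarge Th del th by apply: inTd; rewrite subrr normr0.
have mfh : measurable_fun setT (fun w => f (thhat w) - f th).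
  by apply: measurable_funB => //; exact: measurable_borel_comp.
have mft : measurable_fun setT (fun w => f (gapprox xi n th w) - f th).
  by apply: measurable_funB => //; exact: measurable_borel_comp.
have f2 x y : `|f x - f y| <= 2.
  by have := ler_normB (f x) (f y); have := f1 x; have := f1 y; lra.
set S := (poweR (Sigma_norm _ _ _) _ * _)%E; set V := poweR _ (1 + rho).
set De := Delta_exp _ _ _ _ _ _ _; set Dp := Delta_psi _ _ _ _ _ _ _ _.
set tail := ereal_sup _.
have halfE x y : 2^-1 * (f x - f th) - 2^-1 * (f y - f th) = 2^-1 * (f x - f y) by ring.
have half0 : 0 <= 2^-1 :> R by rewrite invr_ge0.
have half1 : 2^-1 <= 1 :> R by rewrite invf_le1// ler1n.
have sub_enl x : enlarge Th (2^-1 * del) x -> enlarge Th del x.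
  move=> [y [Ty xy]]; exists y; split=> //; apply: lt_le_trans xy _.
  by rewrite ler_piMl// ltW.
have gball : holder_ball (1 + rho) (enlarge Th (2^-1 * del))
    (fun x => 2^-1 * (f x - f th)).
  have g1 x : `|2^-1 * (f x - f th)| <= 1.
    by rewrite normrM ger0_norm//; have := f2 x th; lra.
  split=> //; first exact: borel_fun_half.
  rewrite ifF; last by apply/negbTE; rewrite -ltNge ltrDl.
  rewrite addrAC subrr add0r.
  have gE : (fun x => 2^-1 * (f x - f th)) = 2^-1 *: (f - cst (f th)).
    by apply/funext.
  have gd x : differentiable f x -> differentiable (fun x => 2^-1 * (f x - f th)) x.
    move=> dfx; rewrite gE; by apply: differentiableZ; apply: differentiableB.
  have dgE x h : differentiable f x ->
      'd (fun x => 2^-1 * (f x - f th)) x h = 2^-1 * 'd f x h.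
    move=> dfx; rewrite gE diffZ; last by apply: differentiableB.
    by rewrite diffB// diff_cst /= subr0.
  split=> // [x /sub_enl Ux|x y /sub_enl Ux /sub_enl Uy|x y h /sub_enl Ux /sub_enl Uy xy].
  - exact/gd/fd.
  - rewrite halfE normrM ger0_norm//; apply: le_trans (fL x y Ux Uy).
    by rewrite ler_piMl.
  - rewrite !dgE; [|exact: fd|exact: fd].
    rewrite -mulrBr normrM ger0_norm//; apply: le_trans (fH x y h Ux Uy xy).
    by rewrite ler_piMl.
have gD := Delta_psi_ub P thhat Q xi n Tdth gball.
have Dp0 : (0 <= Dp)%E by exact: le_trans (abse_ge0 _) gD.
have De0 : (0 <= De)%E.
  apply: le_trans (abse_ge0 _) (_ : `|_| <= De)%E; apply: ereal_sup_ubound.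
  by exists th, (fun x => 2^-1 * (f x - f th)).
have S0 : (0 <= S)%E by rewrite mule_ge0 ?poweR_ge0// lee_fin ltW.
have V0 : (0 <= V)%E by exact: poweR_ge0.
have tail_th : ((Num.sqrt (psi_tilde psi
    (fine (Q [set w | (2^-1 * del * Num.sqrt n%:R <= `|xi th w|)%R]))))%:E <= tail)%E.
  by apply: ereal_sup_ubound; exists th.
have tail0 : (0 <= tail)%E by apply: le_trans tail_th; rewrite lee_fin sqrtr_ge0.
(* As [f] is 1-Lipschitz near [th], its derivative lies in the dual ball, and the second moment of
   [u (xi th)] is dominated by [Sigma_norm] taken with both functionals equal to [u]. *)
set u : E -> R := 'd f th.
have du : @dual_ball _ E u.
  split; first by move=> b x y; rewrite /u linearP.
  apply: (diff_norm_le (fd _ Tdth) del0) => y /inTd Uy.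
  exact: fL.
pose A := [set w | 2^-1 * del * Num.sqrt n%:R <= `|xi th w|].
have mA : measurable A.
  by rewrite -[X in measurable X]setTI; apply: measurable_fun_le.
(* On [A] the increment is bounded by 2, that is, by two indicators; off [A] the shift is shorter
   than [del], so Taylor's formula applies inside [enlarge Th del]. *)
have taylor w : `|f (gapprox xi n th w) - f th| <=
    `|u (a *: xi th w)| + (`| `|a *: xi th w| `^ (1 + rho) | +
      (`| \1_A w | + `| \1_A w |)).
  rewrite /gapprox -/a; set h := a *: _.
  rewrite [X in _ <= _ + (X + _)]ger0_norm ?powR_ge0// indicE.
  have [wA|wA] := boolP (w \in A).
    rewrite normr1; have := f2 (th + h) th; have := powR_ge0 `|h| (1 + rho).
    have := normr_ge0 (u h); lra.
  rewrite normr0 !addr0.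
  have hd : `|h| < del.
    move: wA; rewrite notin_setE /A /= => /negP; rewrite -ltNge => wA.
    rewrite /h normrZ gtr0_norm// /a ltr_pdivrMl ?sqrtr_gt0 ?ltr0n//.
    apply: lt_le_trans wA _; rewrite [leRHS]mulrC ler_wpM2r ?sqrtr_ge0//.
    by rewrite ler_piMl// ltW.
  have := @taylor_holder R E rho del f th rho0 (fun y yd => fd y (inTd y yd))
     (fun y k yd yth => fH y th k (inTd y yd) Tdth yth) h hd.
  have := ler_normD (f (th + h) - f th - u h) (u h); rewrite subrK /u; lra.
have mu1 : measurable_fun setT (fun w => u (a *: xi th w)).
  apply: (measurable_borel_comp (f := fun x => u (a *: x))) gx.1.
  apply: borel_fun_continuous; apply: cont_dual_continuous.
  exact: cont_dual_scale (dual_ball_cont_dual du).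
have mu2 : measurable_fun setT (fun w => `|a *: xi th w| `^ (1 + rho)).
  apply: (measurableT_comp (measurable_powR _)).
  by under eq_fun do rewrite normrZ; exact: measurable_funM.
have mu3 : measurable_fun setT (fun w => \1_A w + \1_A w : R).
  by apply: measurable_funD; exact: measurable_indic.
set A' := (S + V + De + Dp + tail)%E.
have A'0 : (0 <= A')%E by rewrite !adde_ge0.
have [SA VA DA tA] : [/\ (S <= A')%E, (V <= A')%E, (Dp <= A')%E & (tail <= A')%E].
  have p1 : (S + V <= A')%E by rewrite /A' -!addeA leeD2l// leeDl// !adde_ge0.
  split.
  - by apply: le_trans p1; rewrite leeDl.
  - by apply: le_trans p1; rewrite leeDr.
  - apply: (@le_trans _ _ (S + V + De + Dp)%E); last by rewrite leeDl.
    by rewrite leeDr// !adde_ge0.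
  - by rewrite leeDr// !adde_ge0.
have scale k X : 0 <= k -> (X <= A' -> k%:E * X <= k%:E * A')%E.
  by move=> k0; apply: lee_wpmul2l; rewrite lee_fin.
have B1 : (Lpsi_norm psi Q (fun w => u (a *: xi th w)) <= C2%:E * A')%E.
  apply: le_trans (HC2 E _ _ Q _ _ _ a0 du gx) _.
  apply: le_trans (scale _ _ (ltW C20) SA); apply: lee_wpmul2l; rewrite ?lee_fin ?(ltW C20)//.
  apply: lee_wpmul2r; first by rewrite lee_fin ltW.
  have Iu : (0 <= \int[Q]_w (u (xi th w) * u (xi th w))%:E)%E.
    by apply: integral_ge0 => w _; rewrite lee_fin -expr2 sqr_ge0.
  have IS : (\int[Q]_w (u (xi th w) * u (xi th w))%:E <= Sigma_norm Q xi Th)%E.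
    apply: ereal_sup_ubound; exists th, u, u; split=> //.
    by rewrite gee0_abs.
  apply: gt0_ler_poweR; rewrite ?in_itv/= ?leey//.
  by rewrite Iu.
  by rewrite (le_trans Iu IS).
have B2 : (Lpsi_norm psi Q (fun w => (`|a *: xi th w| `^ (1 + rho))%R) <= C1%:E * A')%E.
  apply: le_trans (HC1 E _ _ Q _ a sE gx) _.
  apply: le_trans (scale _ _ (ltW C10) VA); apply: lee_wpmul2l; rewrite ?lee_fin ?(ltW C10)//.
  by apply: le_mule_poweR_vxi => //; exact: ltW.
have B3 : (Lpsi_norm psi Q (\1_A : Om' -> R) <= K%:E * A')%E.
  apply: le_trans (HK _ _ Q A mA) _; apply: le_trans (scale _ _ (ltW K0) tA).
  by rewrite EFinM; apply: lee_wpmul2l; rewrite ?lee_fin ?(ltW K0).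
have B4 : (Lpsi_norm psi Q (fun w => (\1_A w + \1_A w)%R) <= (K + K)%:E * A')%E.
  rewrite EFinD ge0_muleDl ?lee_fin//; apply: le_trans (leeD B3 B3).
  by apply: Lpsi_norm_triangle => // w; exact: ler_normD.
have B5 : (Lpsi_norm psi Q (fun w => (f (gapprox xi n th w) - f th)%R) + Dp <= C%:E * A')%E.
  rewrite /C EFinD ge0_muleDl ?lee_fin ?addr_ge0// mul1e; apply: leeD => //.
  rewrite EFinD ge0_muleDl ?lee_fin ?addr_ge0//.
  apply: (@le_trans _ _ (Lpsi_norm psi Q (fun w => u (a *: xi th w)) +
     Lpsi_norm psi Q (fun w => (`|a *: xi th w| `^ (1 + rho) + (\1_A w + \1_A w))%R))%E).
    apply: Lpsi_norm_triangle => //; first exact: measurable_funD.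
    move=> w; apply: le_trans (taylor w) _; rewrite lerD2l.
    by rewrite !ger0_norm ?addr_ge0 ?powR_ge0.
  apply: leeD => //; rewrite EFinD ge0_muleDl ?lee_fin ?addr_ge0//.
  apply: le_trans (leeD B2 B4); apply: Lpsi_norm_triangle => //.
    exact: measurable_funD.
  by move=> w; exact: ler_normD.
have M0 : 0 <= 2 * (1 + c * expR 1).
  by rewrite mulr_ge0// addr_ge0// mulr_ge0 ?expR_ge0// ltW.
have [AA1|A1A] := leP A' 1%E.
  apply: le_trans (Lpsi_norm_transfer Psi mh mt bf f1 gD) _.
  rewrite EFinD ge0_muleDl ?lee_fin ?addr_ge0 ?(ltW Cp)//.
  apply: (@le_trans _ _ ((C + C)%:E * A')%E); last first.
    by rewrite leeDl// mule_ge0// lee_fin.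
  by rewrite EFinD ge0_muleDl ?lee_fin ?(ltW Cp)//; exact: leeD.
rewrite mule1; apply: (@le_trans _ _ (2 * (1 + c * expR 1))%:E).
  by apply: (Lpsi_norm_bounded _ Psi psiexp c0) => // w; exact: f2.
by rewrite lee_fin lerDr addr_ge0// ltW.
Qed.

End FunctionalBounds.

Theorem theorem2p2 (R : realType) :
  (* (i) *)
  (forall (s : R), 0 < s -> s <= 1 ->
   forall psi : R -> R, Psi_class psi ->
   exists2 C : R, 0 < C &
   forall (E : completeNormedModType R) (T Th : set E)
     (d : measure_display) (Om : measurableType d)
     (P : E -> probability Om R) (thhat : Om -> E)
     (d' : measure_display) (Om' : measurableType d')
     (Q : probability Om' R) (xi : E -> Om' -> E) (n : nat),
   separable E -> open T -> open Th -> Th `<=` T ->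
   measE thhat -> (forall w, T (thhat w)) ->
   (forall th, T th -> centered_gaussian Q (xi th)) ->
   (0 < n)%N ->
   forall (f : E -> R) (th : E), holder_ball s setT f -> Th th ->
   (Lpsi_norm psi (P th) (fun w => (f (thhat w) - f th)%R) <=
     C%:E * (poweR (poweR (v_xi Q xi Th * ((n%:R)^-1)%R%:E) (2^-1)%R) s%R
             + Delta_psi psi (holder_ball s setT) Th P thhat Q xi n))%E)
  /\
  (* (ii) *)
  (forall (rho : R), 0 < rho -> rho <= 1 ->
   exists c : R, [/\ 0 < c, c < 1 &
   forall psi : R -> R, Psi_class psi ->
   exists2 C : R, 0 < C &
   forall (E : completeNormedModType R) (T Th : set E)
     (d : measure_display) (Om : measurableType d)
     (P : E -> probability Om R) (thhat : Om -> E)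
     (d' : measure_display) (Om' : measurableType d')
     (Q : probability Om' R) (xi : E -> Om' -> E) (n : nat) (del : R),
   separable E -> open T -> open Th -> Th `<=` T ->
   measE thhat -> (forall w, T (thhat w)) ->
   (forall th, T th -> centered_gaussian Q (xi th)) ->
   (0 < n)%N ->
   0 < del -> enlarge Th del `<=` T ->
   forall (f : E -> R) (th : E),
   holder_ball (1 + rho) (enlarge Th del) f -> Th th ->
   (Lpsi_norm psi (P th) (fun w => (f (thhat w) - f th)%R) <=
     C%:E * Order.min
       (poweR (Sigma_norm Q xi Th) (2^-1)%R * ((Num.sqrt n%:R)^-1)%R%:E
        + poweR (poweR (v_xi Q xi Th * ((n%:R)^-1)%R%:E) (2^-1)%R) (1 + rho)%R
        + Delta_exp (holder_ball (1 + rho)%R (enlarge Th (c * del)%R))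
                    (enlarge Th del) P thhat Q xi n
        + Delta_psi psi (holder_ball (1 + rho)%R (enlarge Th (c * del)%R))
                    (enlarge Th del) P thhat Q xi n
        + ereal_sup [set (Num.sqrt (psi_tilde psi
              (fine (Q [set w | (c * del * Num.sqrt n%:R <= `|xi th' w|)%R]))))%:E
            | th' in Th])
       1)%E]).
Proof.
split=> [s s0 s1 psi Psi|rho rho0 rho1].
  have [C C0 HC] := lipschitz_bound Psi s0 s1; exists C => //.
  move=> E T Th d Om P thhat d' Om' Q xi n sE _ _ ThT mh _ gxi n0 f th.
  exact: HC ThT mh gxi n0 f th.
(* With [1/2], for every [rho], both the smaller neighbourhood and the approximation of [th] off the
   tail event stay inside [enlarge Th del]. *)
exists 2^-1; split; [by rewrite invr_gt0|by rewrite invf_lt1// ltr1n|].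
move=> psi Psi; have [C C0 HC] := smooth_bound Psi rho0 rho1; exists C => //.
move=> E T Th d Om P thhat d' Om' Q xi n del sE _ _ ThT mh _ gxi n0 del0 TdT f th.
exact: HC ThT mh gxi n0 del0 TdT f th.
Qed.
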